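(* Let $\mathcal{H},\mathcal{K}$ be Hilbert spaces and let $A\colon \mathcal{D}(A)\subseteq\mathcal{H}\to\mathcal{K}$ be a closed, densely defined linear operator. Then there exist a $\sigma$-finite Borel measure space $(M,\mu)$, isometries $U\in\mathcal{L}(L^2_\mu,\mathcal{K})$ and $V\in\mathcal{L}(L^2_\mu,\mathcal{H})$, and a measurable function $\sigma\colon M\to[0,\infty)$ that is positive almost everywhere such that $$\mathcal{D}(A)=\{x\in\mathcal{H}: V^*x\in\mathcal{D}(T_\sigma)\}\quad\text{and}\quad Ax=UT_\sigma V^*x\quad\text{for all }x\in\mathcal{D}(A).$$
   Context: All Hilbert spaces are separable and complex. $\mathcal{L}(\mathcal{H},\mathcal{K})$ denotes the bounded linear operators from $\mathcal{H}$ to $\mathcal{K}$, and $L^2_\mu=L^2(M,\mu)$. Bounded operators are included as the case $\mathcal{D}(A)=\mathcal{H}$. An isometry is a linear $U\in\mathcal{L}(\mathcal{H},\mathcal{K})$ with $\langle U\varphi,U\psi\rangle=\langle\varphi,\psi\rangle$ for all $\varphi,\psi$ (not necessarily surjective). For a measurable function $g$ on $M$, the multiplication operator $T_g$ has domain $\mathcal{D}(T_g)=\{f\in L^2_\mu: gf\in L^2_\mu\}$ and acts by $T_gf=gf$. *)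

(* Defs.v *)
From HB Require Import structures.
From mathcomp Require Import all_boot all_order all_algebra.
From mathcomp Require Import all_classical all_reals all_analysis.
From mathcomp Require Import measurable_realfun complex ring_quotient.
From mathcomp Require Import ring lra.

Set Implicit Arguments.
Unset Strict Implicit.
Unset Printing Implicit Defensive.

Import Order.TTheory GRing.Theory Num.Theory.
Import numFieldNormedType.Exports.

Local Open Scope classical_set_scope.
Local Open Scope complex_scope.
Local Open Scope ring_scope.

(* The inner product is linear in its first argument and conjugate-linear in
   the second one. *)
HB.mixin Record Lmodule_isInnerProductSpace (R : realType) H
    & GRing.Lmodule R[i] H := {
  inner : {dot H for @conjc R}
}.

#[short(type="innerProductType")]
HB.structure Definition InnerProductSpace (R : realType) :=
  {H of GRing.Lmodule R[i] H & Lmodule_isInnerProductSpace R H}.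

Notation "''[' x , y ]" := (inner x y) : ring_scope.

HB.mixin Record InnerProductSpace_isHilbert (R : realType) H
    & InnerProductSpace R H & CompleteNormedModule R[i] H := {
  sqr_norm_inner : forall x : H, `|x| ^+ 2 = '[x, x]
}.

#[short(type="hilbertType")]
HB.structure Definition Hilbert (R : realType) :=
  {H of InnerProductSpace R H & CompleteNormedModule R[i] H
      & InnerProductSpace_isHilbert R H}.

Definition separable (T : topologicalType) : Prop :=
  exists2 S : set T, countable S & dense S.

(* Such a [U] is automatically bounded. *)
Definition is_isometry (R : realType) (E F : innerProductType R)
    (U : {linear E -> F}) : Prop :=
  forall x y : E, '[U x, U y] = '[x, y].

Definition is_adjoint (R : realType) (E F : innerProductType R)
    (V : {linear E -> F}) (W : {linear F -> E}) : Prop :=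
  forall (x : E) (y : F), '[V x, y] = '[x, W y].

(* A partially defined map; the values of [action] outside of [domain] are
   irrelevant. *)
Record partial_map (E F : Type) := PartialMap {
  domain : set E;
  action :> E -> F
}.

Definition linear_operator (K : pzRingType) (E F : lmodType K)
    (A : partial_map E F) : Prop :=
  [/\ domain A 0,
      forall a x y, domain A x -> domain A y -> domain A (a *: x + y) &
      forall a x y, domain A x -> domain A y -> A (a *: x + y) = a *: A x + A y].

Definition graph (E F : Type) (A : partial_map E F) : set (E * F) :=
  [set p | domain A p.1 /\ p.2 = A p.1].

Definition closed_operator (E F : topologicalType) (A : partial_map E F) : Prop :=
  closed (graph A).

Definition densely_defined (E : topologicalType) (F : Type)
    (A : partial_map E F) : Prop :=
  dense (domain A).

(* [M] with the sigma-algebra generated by its open sets. *)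
Notation borelType M := (g_sigma_algebraType (@open M)).

Section ComplexFunctions.
Context d (M : measurableType d) (R : realType).
Variable mu : {measure set M -> \bar R}.
Implicit Types f g h : M -> R[i].

(* Equivalent to Borel measurability for the topology of [R[i]]. *)
Definition cmeasurable f : Prop :=
  measurable_fun [set: M] (fun x => complex.Re (f x)) /\
  measurable_fun [set: M] (fun x => complex.Im (f x)).

Definition sqr_modulus f (x : M) : R := complex.Re (f x) ^+ 2 + complex.Im (f x) ^+ 2.

Definition square_integrable f : Prop :=
  cmeasurable f /\ (\int[mu]_x (sqr_modulus f x)%:E < +oo)%E.

Definition cintegral f : R[i] :=
  (\int[mu]_x complex.Re (f x))%R +i* (\int[mu]_x complex.Im (f x))%R.

Definition L2fun_pred : {pred M -> R[i]} := fun f => `[< square_integrable f >].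

Lemma L2fun_predP f : reflect (square_integrable f) (f \in L2fun_pred).
Proof. exact: asboolP. Qed.

Lemma cmeasurableD f g : cmeasurable f -> cmeasurable g -> cmeasurable (f + g).
Proof.
move=> [f1 f2] [g1 g2]; split.
  rewrite (_ : (fun _ => _) = (fun x => complex.Re (f x)) \+ (fun x => complex.Re (g x))).
    exact: measurable_funD.
  by apply/funext => x /=; rewrite fctE; case: (f x) (g x) => [a b] [c e].
rewrite (_ : (fun _ => _) = (fun x => complex.Im (f x)) \+ (fun x => complex.Im (g x))).
  exact: measurable_funD.
by apply/funext => x /=; rewrite fctE; case: (f x) (g x) => [a b] [c e].
Qed.

Lemma cmeasurableM f g : cmeasurable f -> cmeasurable g ->
  cmeasurable (fun x => f x * g x).
Proof.
move=> [f1 f2] [g1 g2]; split.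
  rewrite (_ : (fun _ => _) =
    ((fun x => complex.Re (f x)) \* (fun x => complex.Re (g x))) \-
    ((fun x => complex.Im (f x)) \* (fun x => complex.Im (g x)))).
    by apply: measurable_funB; exact: measurable_funM.
  by apply/funext => x /=; case: (f x) (g x) => [a b] [c e].
rewrite (_ : (fun _ => _) =
  ((fun x => complex.Re (f x)) \* (fun x => complex.Im (g x))) \+
  ((fun x => complex.Im (f x)) \* (fun x => complex.Re (g x)))).
  by apply: measurable_funD; exact: measurable_funM.
by apply/funext => x /=; case: (f x) (g x) => [a b] [c e].
Qed.

Lemma cmeasurable_conj f : cmeasurable f -> cmeasurable (fun x => (f x)^*).
Proof.
move=> [f1 f2]; split.
  by rewrite (_ : (fun _ => _) = (fun x => complex.Re (f x)))//;
    apply/funext => x; case: (f x).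
rewrite (_ : (fun _ => _) = \- (fun x => complex.Im (f x))).
  exact: measurable_funN.
by apply/funext => x /=; case: (f x).
Qed.

Lemma cmeasurable_cst (a : R[i]) : cmeasurable (fun=> a).
Proof. by split; exact: measurable_cst. Qed.

Lemma measurable_sqr_modulus f : cmeasurable f ->
  measurable_fun [set: M] (sqr_modulus f).
Proof.
by move=> [f1 f2]; apply: measurable_funD; exact: measurable_funX.
Qed.

Lemma sqr_modulus_ge0 f x : 0 <= sqr_modulus f x.
Proof. by rewrite addr_ge0// sqr_ge0. Qed.

Lemma integrable_sqr_modulus f : square_integrable f ->
  mu.-integrable [set: M] (EFin \o sqr_modulus f).
Proof.
move=> [mf fi]; apply/integrableP; split.
  by apply/measurable_EFinP; exact: measurable_sqr_modulus.
by under eq_integral do rewrite /= ger0_norm ?sqr_modulus_ge0//.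
Qed.

Lemma integrable_dom f g (u : M -> R) (c : R) :
  square_integrable f -> square_integrable g -> measurable_fun [set: M] u ->
  (forall x, `|u x| <= c * (sqr_modulus f x + sqr_modulus g x)) ->
  mu.-integrable [set: M] (EFin \o u).
Proof.
move=> fi gi mu' ub.
apply: (@le_integrable _ _ _ mu _ _ _
  (EFin \o (fun x => c * (sqr_modulus f x + sqr_modulus g x)))) => //.
- exact/measurable_EFinP.
- by move=> x _ /=; rewrite lee_fin (le_trans (ub x))// ler_norm.
- rewrite (_ : _ \o _ = (fun x => c%:E *
     ((EFin \o sqr_modulus f) x + (EFin \o sqr_modulus g) x))%E).
    apply: integrableZl => //.
    by apply: integrableD => //; exact: integrable_sqr_modulus.
  by apply/funext => x /=.
Qed.

Lemma L2fun_submod_closed : submod_closed L2fun_pred.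
Proof.
split.
  apply/L2fun_predP; split; first exact: cmeasurable_cst.
  rewrite integral0_eq// => x _.
  by rewrite /sqr_modulus/= expr0n/= addr0.
move=> a f g /L2fun_predP fi /L2fun_predP gi; apply/L2fun_predP.
have m : cmeasurable (a *: f + g).
  apply: cmeasurableD; last exact: gi.1.
  by apply: (@cmeasurableM (fun=> a) f); [exact: cmeasurable_cst|exact: fi.1].
split => //.
have : mu.-integrable [set: M] (EFin \o sqr_modulus (a *: f + g)).
  apply: (@integrable_dom f g _ (2 + 2 * (complex.Re a ^+ 2 + complex.Im a ^+ 2))) => //.
    exact: measurable_sqr_modulus.
  move=> x; rewrite ger0_norm ?sqr_modulus_ge0// /sqr_modulus.
  rewrite !fctE.
  case: a {m} (f x) (g x) => [a1 a2] [u v] [w z] /=.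
  rewrite -subr_ge0.
  rewrite (_ : _ - _ = (a1 * u - a2 * v - w) ^+ 2 + (a1 * v + a2 * u - z) ^+ 2
    + 2 * (u ^+ 2 + v ^+ 2) + 2 * (a1 ^+ 2 + a2 ^+ 2) * (w ^+ 2 + z ^+ 2)).
    by rewrite !addr_ge0// ?sqr_ge0// ?mulr_ge0// ?addr_ge0// ?sqr_ge0.
  ring.
move=> /integrableP[_]; apply: le_lt_trans; apply: ge0_le_integral => //.
- by move=> x _; rewrite lee_fin sqr_modulus_ge0.
- by apply/measurable_EFinP; exact: measurable_sqr_modulus.
- by apply: measurableT_comp => //; apply/measurable_EFinP;
    exact: measurable_sqr_modulus.
- by move=> x _ /=; rewrite lee_fin ler_norm.
Qed.

HB.instance Definition _ := GRing.isSubmodClosed.Build _ _ L2fun_pred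
  L2fun_submod_closed.

Record L2fun := MkL2fun { L2val :> M -> R[i]; L2valP : L2val \in L2fun_pred }.

HB.instance Definition _ := [isSub for L2val].
HB.instance Definition _ := [Choice of L2fun by <:].
HB.instance Definition _ := [SubChoice_isSubLmodule of L2fun by <:].

End ComplexFunctions.

Section ComplexIntegral.
Context d (M : measurableType d) (R : realType).
Variable mu : {measure set M -> \bar R}.
Implicit Types f g h : M -> R[i].

Definition cintegrable f : Prop :=
  mu.-integrable [set: M] (fun x => (complex.Re (f x))%:E) /\
  mu.-integrable [set: M] (fun x => (complex.Im (f x))%:E).

Lemma cintegralD f g : cintegrable f -> cintegrable g ->
  cintegral mu (fun x => f x + g x) = cintegral mu f + cintegral mu g.
Proof.
move=> [f1 f2] [g1 g2]; rewrite /cintegral; apply/eqP; rewrite eq_complex /=.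
rewrite -!RintegralD//; apply/andP; split; apply/eqP; apply: eq_Rintegral => x _;
  by case: (f x) (g x) => [a b] [c e].
Qed.

Lemma cintegralZ (a : R[i]) f : cintegrable f ->
  cintegral mu (fun x => a * f x) = a * cintegral mu f.
Proof.
move: a => [a b] [f1 f2]; rewrite /cintegral; apply/eqP; rewrite eq_complex /=.
have int c (u : M -> R) : mu.-integrable [set: M] (EFin \o u) ->
    mu.-integrable [set: M] (EFin \o (fun x => c * u x)).
  move=> ui; rewrite (_ : _ \o _ = (fun x => c%:E * (EFin \o u) x)%E)//.
  exact: integrableZl.
rewrite -!RintegralZl//.
rewrite -RintegralB; [|by []|exact: int|exact: int].
rewrite -RintegralD; [|by []|exact: int|exact: int].
by apply/andP; split; apply/eqP; apply: eq_Rintegral => x _; case: (f x).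
Qed.

Lemma cintegral_conj f : cintegrable f ->
  cintegral mu (fun x => (f x)^*) = (cintegral mu f)^*.
Proof.
move=> [f1 f2]; rewrite /cintegral; apply/eqP; rewrite eq_complex /=.
apply/andP; split; apply/eqP; first by apply: eq_Rintegral => x _; case: (f x).
rewrite -[RHS]mulN1r -RintegralZl//.
by apply: eq_Rintegral => x _; rewrite mulN1r; case: (f x).
Qed.

Lemma ae_eq_cintegral f g : cmeasurable f -> cmeasurable g ->
  {ae mu, forall x, f x = g x} -> cintegral mu f = cintegral mu g.
Proof.
move=> [f1 f2] [g1 g2] fg; rewrite /cintegral /Rintegral; congr (fine _ +i* fine _).
- apply: ae_eq_integral => //; [exact/measurable_EFinP|exact/measurable_EFinP|].
  by apply: filterS fg => x -> _.
- apply: ae_eq_integral => //; [exact/measurable_EFinP|exact/measurable_EFinP|].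
  by apply: filterS fg => x -> _.
Qed.

Lemma cintegrable_mul_conj f g :
  square_integrable mu f -> square_integrable mu g ->
  cintegrable (fun x => f x * (g x)^*).
Proof.
move=> fi gi.
have [m1 m2] : cmeasurable (fun x => f x * (g x)^*).
  by apply: cmeasurableM; [exact: fi.1|apply: cmeasurable_conj; exact: gi.1].
split.
- apply: (@integrable_dom _ _ _ mu f g _ 1) => // x.
  rewrite /sqr_modulus; case: (f x) (g x) => [a b] [u v] /=; rewrite mul1r.
  have := (sqr_ge0 (a + u), sqr_ge0 (a - u), sqr_ge0 (b + v), sqr_ge0 (b - v)).
  by rewrite ler_norml => -[[[? ?] ?] ?]; apply/andP; split; nra.
- apply: (@integrable_dom _ _ _ mu f g _ 1) => // x.
  rewrite /sqr_modulus; case: (f x) (g x) => [a b] [u v] /=; rewrite mul1r.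
  have := (sqr_ge0 (a + v), sqr_ge0 (a - v), sqr_ge0 (b + u), sqr_ge0 (b - u)).
  by rewrite ler_norml => -[[[? ?] ?] ?]; apply/andP; split; nra.
Qed.

End ComplexIntegral.

Section L2.
Context d (M : measurableType d) (R : realType).
Variable mu : {measure set M -> \bar R}.
Local Notation L2fun := (L2fun mu).

Lemma L2fun_square_integrable (f : L2fun) : square_integrable mu f.
Proof. exact/L2fun_predP/L2valP. Qed.

Lemma L2fun_cmeasurable (f : L2fun) : cmeasurable f.
Proof. by have [] := L2fun_square_integrable f. Qed.

Definition L2null : {pred L2fun} :=
  fun f => `[< {ae mu, forall x, f x = 0} >].

Lemma L2null_submod_closed : submod_closed L2null.
Proof.
split.
  by apply/asboolP; apply/nearW => x.
move=> a f g /asboolP f0 /asboolP g0; apply/asboolP.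
apply: filterS2 f0 g0 => x f0 g0.
by rewrite -[LHS]/(a * f x + g x) f0 g0 mulr0 addr0.
Qed.

HB.instance Definition _ := GRing.isSubmodClosed.Build _ _ L2null
  L2null_submod_closed.

Local Open Scope quotient_scope.

(* Square-integrable functions up to almost everywhere equality. *)
Definition L2 : Type := {ideal_quot L2null}.
HB.instance Definition _ := GRing.Zmodule.on L2.
HB.instance Definition _ := EqQuotient.on L2.

Lemma L2_eqP (f g : L2fun) :
  \pi_L2 f = \pi_L2 g <-> {ae mu, forall x, f x = g x}.
Proof.
have e : (f - g \in L2null) = (\pi_L2 f == \pi_L2 g).
  exact: (Quotient.idealrBE L2null).
split.
  move/eqP; rewrite -e => /asboolP; apply: filterS => x fg0.
  by apply/eqP; rewrite -subr_eq0; apply/eqP; exact: fg0.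
move=> fg; apply/eqP; rewrite -e; apply/asboolP; apply: filterS fg => x fg.
by rewrite -[LHS]/(f x - g x) fg subrr.
Qed.

Lemma L2_repr_ae (f : L2fun) : {ae mu, forall x, repr (\pi_L2 f) x = f x}.
Proof. by apply/L2_eqP; rewrite reprK. Qed.

Lemma L2_piD (f g : L2fun) : \pi_L2 (f + g) = \pi_L2 f + \pi_L2 g.
Proof. exact: (Quotient.pi_add L2null). Qed.

Definition L2scale (a : R[i]) (f : L2) : L2 := \pi_L2 (a *: repr f).

Lemma L2_piZ a (f : L2fun) : \pi_L2 (a *: f) = L2scale a (\pi_L2 f).
Proof.
apply/L2_eqP; apply: filterS (L2_repr_ae f) => x fx.
by rewrite -[LHS]/(a * f x) -[RHS]/(a * repr (\pi_L2 f) x) fx.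
Qed.

Lemma L2scaleA a b f : L2scale a (L2scale b f) = L2scale (a * b) f.
Proof. by elim/quotW: f => f; rewrite -(L2_piZ b f) -2!L2_piZ scalerA. Qed.

Lemma L2scale1 : left_id 1 L2scale.
Proof. by elim/quotW => f; rewrite -L2_piZ scale1r. Qed.

Lemma L2scaleDr : right_distributive L2scale +%R.
Proof.
by move=> a; elim/quotW => f; elim/quotW => g; rewrite -L2_piD -!L2_piZ -L2_piD scalerDr.
Qed.

Lemma L2scaleDl f : {morph L2scale^~ f : a b / a + b}.
Proof. by move=> a b /=; elim/quotW: f => f; rewrite -!L2_piZ -L2_piD scalerDl. Qed.

HB.instance Definition _ := GRing.Zmodule_isLmodule.Build R[i] L2
  L2scaleA L2scale1 L2scaleDr L2scaleDl.

Lemma L2_pi0 : \pi_L2 (0 : L2fun) = 0.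
Proof.
by rewrite -(scale0r (0 : L2fun)) L2_piZ; exact: (scale0r (\pi_L2 (0 : L2fun))).
Qed.

Definition L2inner (f g : L2) : R[i] :=
  cintegral mu (fun x => repr f x * (repr g x)^*).

Lemma L2innerE (f g : L2fun) :
  L2inner (\pi_L2 f) (\pi_L2 g) = cintegral mu (fun x => f x * (g x)^*).
Proof.
have m (u v : L2fun) : cmeasurable (fun x => u x * (v x)^*).
  apply: cmeasurableM; first exact: L2fun_cmeasurable.
  by apply: cmeasurable_conj; exact: L2fun_cmeasurable.
apply: ae_eq_cintegral; [exact: m|exact: m|].
apply: filterS2 (L2_repr_ae f) (L2_repr_ae g) => x fx gx.
by rewrite fx gx.
Qed.

Lemma L2inner_linear g : scalar (L2inner^~ g).
Proof.
move=> a; elim/quotW: g => g; elim/quotW => f; elim/quotW => h.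
rewrite -[a *: _]/(L2scale a _) -L2_piZ -L2_piD !L2innerE.
have fg := cintegrable_mul_conj (L2fun_square_integrable f)
  (L2fun_square_integrable g).
have hg := cintegrable_mul_conj (L2fun_square_integrable h)
  (L2fun_square_integrable g).
have afg := cintegrable_mul_conj (L2fun_square_integrable (a *: f))
  (L2fun_square_integrable g).
rewrite -cintegralZ// -cintegralD//.
  by congr cintegral; apply/funext => x;
    rewrite -[(a *: f + h) x]/(a * f x + h x) mulrDl mulrA.
by under eq_fun do rewrite mulrA.
Qed.

Lemma L2inner_conj f g : L2inner f g = (L2inner g f)^*.
Proof.
elim/quotW: f => f; elim/quotW: g => g; rewrite !L2innerE.
rewrite -cintegral_conj; last first.
  by apply: cintegrable_mul_conj; exact: L2fun_square_integrable.
congr cintegral; apply/funext => x; case: (f x) (g x) => [a b] [u v].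
by apply/eqP; rewrite eq_complex /=; apply/andP; split; apply/eqP; ring.
Qed.

Lemma L2inner_conj_linear f : linear_for (@conjc R \; *%R) (L2inner f).
Proof.
move=> a g h /=; rewrite L2inner_conj L2inner_linear rmorphD rmorphM/=.
by rewrite -!L2inner_conj.
Qed.

Lemma L2inner_gt0 f : f != 0 -> 0 < L2inner f f.
Proof.
elim/quotW: f => f; rewrite L2innerE -L2_pi0 => f0.
have -> : cintegral mu (fun x => f x * (f x)^*) =
    (\int[mu]_x sqr_modulus f x)%R +i* 0.
  rewrite /cintegral; congr (_ +i* _).
    apply: eq_Rintegral => x _; rewrite /sqr_modulus.
    by case: (f x) => a b /=; rewrite mulrN opprK -!expr2.
  rewrite -[RHS](mul0r (fine (mu setT))) -Rintegral_cst//.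
  apply: eq_Rintegral => x _.
  by case: (f x) => a b /=; rewrite mulrN (mulrC b) addNr.
rewrite ltcE /= eqxx /= lt_neqAle; apply/andP; split; last first.
  by apply: Rintegral_ge0 => x _; exact: sqr_modulus_ge0.
apply/eqP => int0; move/eqP: f0; apply; apply/L2_eqP.
have fi := integrable_sqr_modulus (L2fun_square_integrable f).
have : (\int[mu]_x (sqr_modulus f x)%:E = 0)%E.
  rewrite -[LHS]fineK; last exact: integrable_fin_num.
  by congr EFin; exact/esym/int0.
move=> {}int0.
have /ae_eq_integral_abs : measurable_fun [set: M] (EFin \o sqr_modulus f).
  by apply/measurable_EFinP; exact/measurable_sqr_modulus/L2fun_cmeasurable.
move=> /(_ mu measurableT)[+ _].
under eq_integral do rewrite gee0_abs ?lee_fin ?sqr_modulus_ge0//.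
move=> /(_ int0); apply: filterS => x /(_ I)/= [].
rewrite /sqr_modulus => /eqP; rewrite paddr_eq0 ?sqr_ge0// !sqrf_eq0.
by rewrite -[RHS]/(0 : R[i]); case: (f x) => a b /= /andP[/eqP-> /eqP->].
Qed.

HB.instance Definition _ := bilinear_isBilinear.Build R[i] L2 L2 R[i]
  *%R (@conjc R \; *%R) L2inner (L2inner_linear, L2inner_conj_linear).

Lemma L2inner_hermitian f g : L2inner f g = (-1) ^+ false * (L2inner g f)^*.
Proof. by rewrite expr0 mul1r L2inner_conj. Qed.

HB.instance Definition _ := isHermitianSesquilinear.Build R[i] L2 false
  (@conjc R) L2inner L2inner_hermitian.

HB.instance Definition _ := isDotProduct.Build R[i] L2 L2inner L2inner_gt0.

HB.instance Definition _ := Lmodule_isInnerProductSpace.Build R L2 L2inner.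

(* The class of [h] if [h] is square-integrable, and 0 otherwise. *)
Definition in_L2 (h : M -> R[i]) : L2 := \pi_L2 (insubd 0 h).

Lemma in_L2_ae (h : M -> R[i]) : square_integrable mu h ->
  {ae mu, forall x, repr (in_L2 h) x = h x}.
Proof.
move=> hi; have hE : (insubd 0 h : L2fun) = h :> (M -> R[i]).
  by apply: (@insubdK _ _ L2fun); exact/L2fun_predP.
by apply: filterS (L2_repr_ae (insubd 0 h)) => x; rewrite hE.
Qed.

(* Multiplication by [g], with its maximal domain. *)
Definition mulop (g : M -> R[i]) : partial_map L2 L2 := {|
  domain := [set f : L2 | square_integrable mu (fun x => g x * repr f x)];
  action := fun f : L2 => in_L2 (fun x => g x * repr f x)
|}.

Lemma ae_eq_square_integrable (f h : M -> R[i]) : cmeasurable h ->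
  {ae mu, forall x, f x = h x} -> square_integrable mu f -> square_integrable mu h.
Proof.
move=> mh fh [mf fi]; split => //.
rewrite -(@ae_eq_integral _ _ _ mu _ _ (EFin \o sqr_modulus f))//.
- by apply/measurable_EFinP; exact: measurable_sqr_modulus.
- by apply/measurable_EFinP; exact: measurable_sqr_modulus.
- by apply: filterS fh => x fx _; rewrite /= /sqr_modulus fx.
Qed.

Lemma mulop_domainE (g : M -> R[i]) (f : L2fun) : cmeasurable g ->
  domain (mulop g) (\pi_L2 f) <-> square_integrable mu (fun x => g x * f x).
Proof.
move=> mg; have m (u : L2fun) : cmeasurable (fun x => g x * u x).
  by apply: cmeasurableM => //; exact: L2fun_cmeasurable.
by split; apply: ae_eq_square_integrable; rewrite //; apply: filterS (L2_repr_ae f) => x ->.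
Qed.

Lemma L2_ext (f h : L2) : {ae mu, forall x, repr f x = repr h x} -> f = h.
Proof. by move/L2_eqP; rewrite !reprK. Qed.

Lemma L2_repr_linear (a : R[i]) (f h : L2) :
  {ae mu, forall x, repr (a *: f + h) x = a * repr f x + repr h x}.
Proof.
have : \pi_L2 (repr (a *: f + h)) = \pi_L2 (a *: repr f + repr h).
  by rewrite reprK L2_piD L2_piZ !reprK.
by move/L2_eqP.
Qed.

Lemma mulop_linear (g : M -> R[i]) : cmeasurable g ->
  linear_operator (mulop g).
Proof.
move=> mg.
pose G (f : L2) x := g x * repr f x.
have m f : cmeasurable (G f).
  by apply: cmeasurableM => //; exact: L2fun_cmeasurable.
have lin a f h : {ae mu, forall x, a * G f x + G h x = G (a *: f + h) x}.
  apply: filterS (L2_repr_linear a f h) => x; rewrite /G => ->.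
  by rewrite mulrDr mulrCA.
have int a f h : domain (mulop g) f -> domain (mulop g) h ->
    square_integrable mu (G (a *: f + h)).
  move=> df dh; apply: ae_eq_square_integrable (m _) (lin a f h) _.
  apply/L2fun_predP; apply: (L2fun_submod_closed mu).2; exact/L2fun_predP.
split => [||a f h df dh]; last 2 first.
- exact: int.
- have di := int a f h df dh.
  have e : {ae mu, forall x, repr (a *: mulop g f + mulop g h) x =
      a * G f x + G h x}.
    apply: filterS3 (L2_repr_linear a (mulop g f) (mulop g h))
      (in_L2_ae df) (in_L2_ae dh) => x ->.
    by rewrite /= => -> ->.
  by apply: L2_ext; apply: filterS3 (in_L2_ae di) (lin a f h) e => x -> -> ->.
- rewrite -L2_pi0; apply/mulop_domainE => //.
  rewrite (_ : (fun _ => _) = 0); last by apply/funext => x; rewrite mulr0.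
  apply/L2fun_predP; exact: (L2fun_submod_closed mu).1.
Qed.

End L2.

(* Main.v *)
(* Let [B] be the inverse of [1 + A^* A]: the pair [(B y, A (B y))] is the orthogonal
   projection of [(y, 0)] on the graph of [A], so [B] is self-adjoint, [0 <= B <= 1], [B] is
   injective, and the kernel of [1 - B] is contained in that of [A]. Split the orthogonal
   complement of the kernel of [1 - B] into countably many cyclic subspaces for [B]. On
   the one generated by [v], the numbers [<B^k (1 - B)^l v, v>] are nonnegative, hence [v]
   has a spectral measure on [0, 1] by the Hausdorff moment theorem. Placing these
   measures on disjoint copies of the line gives a measure [mu] and an isometry [V] from
   its L2 space which turns the coordinate [beta] into [B] and whose range is that
   orthogonal complement; moreover [0 < beta < 1] almost everywhere.

   Put [sigma = sqrt ((1 - beta) / beta)]. Since [|A B y|^2 = <B y, y> - |B y|^2], the map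
   [sqrt (beta (1 - beta)) f |-> A B V f] extends to an isometry [U], and [A V f] is
   [U (sigma f)] when [f] is supported on a set where [beta] is bounded away from 0. The
   general case follows by truncation: closedness of [A] gives one inclusion between the
   domains, and [|sigma f|^2 <= |A x|^2] on the truncated sets, where [f = V^* x], gives
   the other. *)

Require Import Defs.
From HB Require Import structures.
From mathcomp Require Import all_boot all_order all_algebra.
From mathcomp Require Import all_classical all_reals all_analysis.
From mathcomp Require Import measurable_realfun complex.
From mathcomp Require Import ring lra zify.

Import Order.TTheory GRing.Theory Num.Theory.
Import numFieldNormedType.Exports.

Local Open Scope classical_set_scope.
Local Open Scope complex_scope.
Local Open Scope ring_scope.

Set Implicit Arguments.
Unset Strict Implicit.
Unset Printing Implicit Defensive.

(** * Inner products and projections *)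

(** No spectral theorem is assumed for [B]: existence and uniqueness in the moment problem on [0, 1]
    stand in for it. This is one reason to work with [B] and not with A^* A, whose spectrum may be
    unbounded, so that its moments need not exist or determine a measure.

    The kernel of [1 - B] is set aside because sigma vanishes where beta = 1, whereas sigma has to
    be positive almost everywhere. Nothing is lost: [V] need not be surjective, and [A] is zero on
    that kernel.

    Orthogonal projection on a closed subspace is the one geometric tool. Applied to subspaces of a
    product, it gives the resolvent, the adjoint of an isometry, and the extension of an isometry
    from a total family; no extension by density is carried out. *)

Section InnerProductTheory.
Context (R : realType) (E : innerProductType R).
Implicit Types (x y z : E) (a : R[i]) (u : nat -> E).

Lemma innerC x y : '[x, y] = ('[y, x])^*.
Proof. by rewrite (hermC (theta := conjc)) expr0 mul1r. Qed.

Lemma innerDl x y z : '[x + y, z] = '[x, z] + '[y, z].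
Proof. exact: (linearDl inner). Qed.

Lemma innerDr x y z : '[z, x + y] = '[z, x] + '[z, y].
Proof. exact: (linearDr inner). Qed.

Lemma innerZl a x y : '[a *: x, y] = a * '[x, y].
Proof. exact: (linearZl_LR inner). Qed.

Lemma innerZr a x y : '[x, a *: y] = a^* * '[x, y].
Proof. exact: (linearZr_LR inner). Qed.

Lemma innerNl x y : '[- x, y] = - '[x, y].
Proof. by rewrite -scaleN1r innerZl mulN1r. Qed.

Lemma innerNr x y : '[x, - y] = - '[x, y].
Proof. by rewrite innerC innerNl [in RHS]innerC rmorphN. Qed.

Lemma innerBl x y z : '[x - y, z] = '[x, z] - '[y, z].
Proof. by rewrite innerDl innerNl. Qed.

Lemma innerBr x y z : '[z, x - y] = '[z, x] - '[z, y].
Proof. by rewrite innerDr innerNr. Qed.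

Lemma inner0l x : '[0, x] = 0.
Proof. by rewrite -(scale0r 0) innerZl mul0r. Qed.

Lemma inner0r x : '[x, 0] = 0.
Proof. by rewrite innerC inner0l rmorph0. Qed.

Lemma innerl_inj x y : (forall z, '[x, z] = '[y, z]) -> x = y.
Proof.
move=> xy; apply/eqP; rewrite -subr_eq0; apply/negPn/negP => xy0.
by have := dnorm_gt0 inner (x - y); rewrite xy0 innerBl xy subrr ltxx.
Qed.

Definition rdot x y : R := complex.Re '[x, y].

Definition sqn x : R := rdot x x.

Lemma rdotC x y : rdot x y = rdot y x.
Proof. by rewrite /rdot innerC; case: ('[y, x]). Qed.

Lemma rdotDl x y z : rdot (x + y) z = rdot x z + rdot y z.
Proof. by rewrite /rdot innerDl; case: ('[x, z]) ('[y, z]) => [a b] []. Qed.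

Lemma rdotDr x y z : rdot z (x + y) = rdot z x + rdot z y.
Proof. by rewrite !(rdotC z) rdotDl. Qed.

Lemma rdotNl x y : rdot (- x) y = - rdot x y.
Proof. by rewrite /rdot innerNl; case: ('[x, y]). Qed.

Lemma rdotNr x y : rdot x (- y) = - rdot x y.
Proof. by rewrite !(rdotC x) rdotNl. Qed.

Lemma rdotZl (t : R) x y : rdot (t%:C *: x) y = t * rdot x y.
Proof. by rewrite /rdot innerZl; case: ('[x, y]) => a b /=; rewrite mul0r subr0. Qed.

Lemma rdotZr (t : R) x y : rdot x (t%:C *: y) = t * rdot x y.
Proof. by rewrite !(rdotC x) rdotZl. Qed.

Lemma rdot0r x : rdot x 0 = 0.
Proof. by rewrite /rdot inner0r. Qed.

(** The real part of ['['i *: x, y]] is minus the imaginary part of ['[x, y]]. Orthogonality to a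
    complex subspace can thus be proved with real parts only. *)
Lemma rdot_eq0 x y : rdot x y = 0 -> rdot ('i *: x) y = 0 -> '[x, y] = 0.
Proof.
rewrite /rdot innerZl; case: ('[x, y]) => a b /= ->.
by rewrite mul0r mul1r sub0r => /eqP; rewrite oppr_eq0 => /eqP ->.
Qed.

Lemma sqnE x : '[x, x] = (sqn x)%:C.
Proof.
have : 0 <= '[x, x] by exact: dnorm_ge0.
by rewrite lecE/= => /andP[/eqP + _]; rewrite /sqn /rdot; case: ('[x, x]) => a b /= ->.
Qed.

Lemma sqn_ge0 x : 0 <= sqn x.
Proof. by have : 0 <= '[x, x] := dnorm_ge0 inner x; rewrite sqnE lecR. Qed.

Lemma sqn_eq0 x : sqn x = 0 -> x = 0.
Proof.
by move=> x0; apply/eqP; have := dnorm_eq0 inner x; rewrite sqnE x0 eqxx.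
Qed.

Lemma sqn0 : sqn 0 = 0.
Proof. by rewrite /sqn rdot0r. Qed.

Lemma sqnN x : sqn (- x) = sqn x.
Proof. by rewrite /sqn rdotNl rdotNr opprK. Qed.

Lemma sqnBC x y : sqn (x - y) = sqn (y - x).
Proof. by rewrite -sqnN opprB. Qed.

Lemma sqnD x y : sqn (x + y) = sqn x + 2 * rdot x y + sqn y.
Proof. by rewrite /sqn rdotDl !rdotDr (rdotC y x); ring. Qed.

Lemma sqnB x y : sqn (x - y) = sqn x - 2 * rdot x y + sqn y.
Proof. by rewrite sqnD sqnN rdotNr mulrN. Qed.

Lemma sqnZ (t : R) x : sqn (t%:C *: x) = t ^+ 2 * sqn x.
Proof. by rewrite /sqn rdotZl rdotZr mulrA expr2. Qed.

Lemma rdot_CauchySchwarz x y : rdot x y ^+ 2 <= sqn x * sqn y.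
Proof.
have [/sqn_eq0 ->|y0] := eqVneq (sqn y) 0.
  by rewrite rdot0r sqn0 expr0n/= mulr0.
have yp : 0 < sqn y by rewrite lt_neqAle eq_sym y0 sqn_ge0.
have := sqn_ge0 ((sqn y)%:C *: x - (rdot x y)%:C *: y).
rewrite sqnB !sqnZ rdotZl rdotZr => h.
rewrite -(ler_pM2l yp); nra.
Qed.
End InnerProductTheory.

Section Convergence.
Context (R : realType) (E : innerProductType R).
Implicit Types (x y z : E) (u v : nat -> E).

(** Convergence is expressed by [sqn] so that the same lemmas serve Hilbert spaces as well as
    products and [L2], which are used here through their inner product alone. *)
Definition ip_cvg u x : Prop := (fun n => sqn (u n - x)) @ \oo --> (0 : R).

Definition ip_cauchy u : Prop :=
  forall e : R, 0 < e ->
    exists N, forall m n, (N <= m)%N -> (N <= n)%N -> sqn (u m - u n) <= e.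

Lemma rdot_le x y : `|rdot x y| <= Num.sqrt (sqn x) * Num.sqrt (sqn y).
Proof.
by rewrite -sqrtrM ?sqn_ge0// -sqrtr_sqr ler_sqrt ?mulr_ge0 ?sqn_ge0// rdot_CauchySchwarz.
Qed.

Lemma ip_cvg_rdot u x y : ip_cvg u x -> (fun n => rdot (u n) y) @ \oo --> rdot x y.
Proof.
move=> ux; apply/cvgrPdistC_le => e e0.
have : (fun n => Num.sqrt (sqn (u n - x)) * Num.sqrt (sqn y)) @ \oo --> (0 : R).
  rewrite -[X in _ --> X](mul0r (Num.sqrt (sqn y))); apply: cvgMr_tmp.
  rewrite -[X in _ --> X]sqrtr0; apply: continuous_cvg => //; exact: sqrt_continuous.
move=> /cvgr0Pnorm_le /(_ e e0); apply: filterS => n; apply: le_trans.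
by rewrite -rdotNl -rdotDl (le_trans (rdot_le _ _))// ler_norm.
Qed.

Lemma ip_cvg_inner0 u x y : ip_cvg u x -> (forall n, '[u n, y] = 0) -> '[x, y] = 0.
Proof.
move=> ux uy.
have r0 z : (forall n, '[u n, z] = 0) -> rdot x z = 0.
  move=> uz; have /cvg_lim <- // := ip_cvg_rdot (y := z) ux.
  have -> : (fun n => rdot (u n) z) = (fun=> 0) by apply/funext => n; rewrite /rdot uz.
  exact: lim_cst.
rewrite innerC rdot_eq0 ?rmorph0 //; rewrite rdotC r0// => n.
by rewrite innerZr uy mulr0.
Qed.

Lemma sqnD_le x y : sqn (x + y) <= 2 * sqn x + 2 * sqn y.
Proof.
have := sqn_ge0 (x - y); rewrite sqnB sqnD; lra.
Qed.

Lemma ip_cvg_unique u x y : ip_cvg u x -> ip_cvg u y -> x = y.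
Proof.
move=> ux uy; apply/eqP; rewrite -subr_eq0; apply/eqP/sqn_eq0.
apply/eqP; rewrite eq_le sqn_ge0 andbT.
have : (fun n => 2 * sqn (u n - x) + 2 * sqn (u n - y)) @ \oo --> (2 * 0 + 2 * 0 : R).
  by apply: cvgD; apply: cvgMl_tmp.
rewrite mulr0 addr0 => h; rewrite -[leRHS](cvg_lim _ h)//.
apply: limr_ge; first by apply/cvg_ex; exists 0.
apply: nearW => n; rewrite (sqnBC (u n) x).
have -> : x - y = (x - u n) + (u n - y) by rewrite addrA subrK.
exact: sqnD_le.
Qed.

End Convergence.

Section Projection.
Context (R : realType) (E : innerProductType R).

Definition ip_complete : Prop :=
  forall u : nat -> E, ip_cauchy u -> exists x, ip_cvg u x.

Definition closed_subspace (S : set E) : Prop :=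
  [/\ S 0, forall a x y, S x -> S y -> S (a *: x + y) &
      forall u x, (forall n, S (u n)) -> ip_cvg u x -> S x].

Lemma closed_subspace_perp (Y : set E) :
  closed_subspace [set x | forall y, Y y -> '[x, y] = 0].
Proof.
split=> [y _|a x x' hx hx' y Yy|u x hu ux y Yy].
- by rewrite inner0l.
- by rewrite innerDl innerZl hx// hx'// mulr0 addr0.
- by apply: ip_cvg_inner0 ux _ => n; exact: hu.
Qed.

(** A minimizing sequence for the distance to [x] is Cauchy by the parallelogram law. Orthogonality
    is obtained approximately along this sequence and passed to the limit, so attainment of the
    infimum is never discussed. *)
Lemma projection_theorem (S : set E) (x : E) : ip_complete -> closed_subspace S ->
  exists2 p, S p & forall s, S s -> '[x - p, s] = 0.
Proof.
move=> cE [S0 SD Scl].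
pose D := [set sqn (x - s) | s in S].
have D_inf : has_inf D.
  split; first by exists (sqn (x - 0)); exists 0.
  by exists 0 => _ [s _ <-]; exact: sqn_ge0.
pose d := inf D.
have dP s : S s -> d <= sqn (x - s) by move=> Ss; apply: (inf_lbound D_inf.2); exists s.
have /choice[s sP] (n : nat) : exists s, S s /\ sqn (x - s) < d + n.+1%:R^-1.
  have [_ [s Ss <-] sd] := inf_adherent (ltac:(by rewrite invr_gt0) : 0 < n.+1%:R^-1 :> R) D_inf.
  by exists s.
(* Parallelogram law: the midpoint of [s m] and [s n] lies in [S], hence is at squared distance at
   least [d] from [x]. *)
have half m n : sqn (s m - s n) <= 2 * m.+1%:R^-1 + 2 * n.+1%:R^-1.
  have Sh : S ((2^-1)%:C *: (s m + s n)).
    rewrite -[_ *: _]addr0; apply: (SD) => //.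
    by rewrite -[s m]scale1r; apply: (SD); [exact: (sP m).1|exact: (sP n).1].
  have := dP _ Sh; have := (sP m).2; have := (sP n).2.
  have -> : x - (2^-1)%:C *: (s m + s n) = (2^-1)%:C *: ((x - s m) + (x - s n)).
    rewrite !scalerDr !scalerN addrACA -!opprD.
    by rewrite -scalerDl -rmorphD (_ : 2^-1 + 2^-1 = 1 :> R) ?scale1r//; lra.
  have -> : s m - s n = (x - s n) - (x - s m) by rewrite opprB [RHS]addrC addrA subrK.
  move: (x - s n) (x - s m) => b a; rewrite sqnZ sqnB sqnD rdotC expr2.
  by move: (m.+1%:R^-1 : R) (n.+1%:R^-1 : R) (sqn a) (sqn b) (rdot b a) => i j *; lra.
have [p sp] : exists p, ip_cvg s p.
  apply: cE => e e0.
  have [N N4] : exists N : nat, 4 / e < N.+1%:R.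
    exists (Num.truncn (4 / e)); exact: truncnS_gt.
  exists N => m n Nm Nn; apply: le_trans (half m n) _.
  have inv k : (N <= k)%N -> k.+1%:R^-1 <= e / 4 :> R.
    move=> Nk; rewrite -[leRHS]invrK lef_pV2 ?posrE ?invr_gt0 ?divr_gt0//.
    by rewrite invf_div (le_trans (ltW N4))// ler_nat.
  move: (inv _ Nm) (inv _ Nn).
  by move: (m.+1%:R^-1 : R) (n.+1%:R^-1 : R) => i j *; lra.
have Sp : S p by apply: Scl sp => n; exact: (sP n).1.
exists p => // .
have r0 t : S t -> rdot (x - p) t = 0.
  move=> St; apply/eqP; rewrite -sqrf_eq0 eq_le sqr_ge0 andbT.
  have cs : (fun n => rdot (x - s n) t) @ \oo --> rdot (x - p) t.
    rewrite rdotDl rdotNl.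
    have -> : (fun n => rdot (x - s n) t) = (fun n => rdot x t - rdot (s n) t).
      by apply/funext => n; rewrite rdotDl rdotNl.
    by apply: cvgB; [exact: cvg_cst|exact: ip_cvg_rdot].
  have cs2 : (fun n => rdot (x - s n) t ^+ 2) @ \oo --> rdot (x - p) t ^+ 2.
    by rewrite expr2; under eq_fun do rewrite expr2; exact: cvgM.
  have cb : (fun n => sqn t * n.+1%:R^-1 : R) @ \oo --> (0 : R).
    rewrite -[X in _ --> X](mulr0 (sqn t)); apply: cvgMl_tmp; exact: cvg_harmonic.
  apply: ler_cvg_to cs2 cb _; apply: nearW => n.
  have [sn sdn] := sP n; set r := rdot (x - s n) t; set q := sqn t.
  have [t0|t0] := eqVneq q 0.
    have -> : r = 0 by rewrite /r (sqn_eq0 t0) rdot0r.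
    by rewrite t0 expr0n/= mul0r.
  have q0 : 0 < q by rewrite lt_neqAle eq_sym t0 sqn_ge0.
  (* The competitor moves [s n] by the projection of [x - s n] on the line of [t]. It lowers the
     squared distance by [r ^+ 2 / q], which therefore cannot exceed the slack [n.+1%:R^-1]. *)
  have : S ((r / q)%:C *: t + s n) by exact: SD.
  move=> /dP.
  have -> : x - ((r / q)%:C *: t + s n) = (x - s n) - (r / q)%:C *: t.
    by rewrite opprD addrA addrAC.
  rewrite sqnB rdotZr sqnZ -/r -/q => h.
  have e1 : 2 * (r / q * r) - (r / q) ^+ 2 * q = r ^+ 2 / q by field.
  have : r ^+ 2 / q <= n.+1%:R^-1.
    move: h sdn; rewrite -e1.
    by move: (n.+1%:R^-1 : R) (r / q * r) ((r / q) ^+ 2 * q) (sqn _) => *; lra.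
  by rewrite ler_pdivrMr// mulrC.
move=> t St; rewrite innerC rdot_eq0 ?rmorph0// rdotC r0//.
by rewrite -[_ *: _]addr0; exact: SD.
Qed.

End Projection.

(** * Hilbert spaces and closed operators *)

Section HilbertTopology.
Context (R : realType) (H : hilbertType R).
Implicit Types (x y : H) (u : nat -> H).

Lemma hilbert_normE x : `|x| = (Num.sqrt (sqn x))%:C.
Proof.
apply/eqP; rewrite -(@eqrXn2 _ 2)// ?lecR ?sqrtr_ge0//.
by rewrite sqr_norm_inner sqnE -rmorphXn/= sqr_sqrtr ?sqn_ge0.
Qed.

Lemma hilbert_norm_lt x (e : R) : 0 < e -> (`|x| < e%:C) = (sqn x < e ^+ 2).
Proof.
by move=> e0; rewrite hilbert_normE ltcR -[in RHS](sqr_sqrtr (sqn_ge0 x)) ltr_pXn2r ?nnegrE ?sqrtr_ge0 ?ltW.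
Qed.

Lemma complex_gt0E (e : R[i]) : 0 < e -> exists2 r : R, 0 < r & e = r%:C.
Proof. by case: e => a b; rewrite ltcE/= => /andP[/eqP-> a0]; exists a. Qed.

Lemma ip_cvg_hilbert u x : ip_cvg u x -> u @ \oo --> x.
Proof.
move=> ux; apply/cvgrPdistC_lt => _ /complex_gt0E[e e0 ->].
have e20 : 0 < e ^+ 2 by rewrite exprn_gt0.
move/cvgr0Pnorm_lt : ux => /(_ _ e20); apply: filterS => n.
by rewrite ger0_norm ?sqn_ge0// hilbert_norm_lt.
Qed.

Lemma hilbert_complete : ip_complete H.
Proof.
move=> u uc.
have : cvg (u @ \oo).
  apply/cauchy_cvgP/cauchy_exP => _ /complex_gt0E[e e0 ->].
  have [N uN] := uc (e ^+ 2 / 4) (ltac:(by rewrite divr_gt0// exprn_gt0)).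
  exists (u N); exists N => // n /= Nn; rewrite -ball_normE/= hilbert_norm_lt//.
  apply: le_lt_trans (uN _ _ (leqnn N) Nn) _.
  have : 0 < e ^+ 2 by rewrite exprn_gt0.
  lra.
move=> /cvg_ex[x ux]; exists x; apply/cvgr0Pnorm_lt => e e0.
have e'0 : 0 < (Num.sqrt e)%:C :> R[i] by rewrite ltcR sqrtr_gt0.
move/cvgrPdistC_lt : ux => /(_ _ e'0); apply: filterS => n.
by rewrite hilbert_norm_lt ?sqrtr_gt0// sqr_sqrtr ?ltW// ger0_norm ?sqn_ge0.
Qed.

Lemma dense_sqn (S : set H) x (e : R) : dense S -> 0 < e ->
  exists2 s, S s & sqn (s - x) < e.
Proof.
move=> dS e0; have s0 : 0 < Num.sqrt e by rewrite sqrtr_gt0.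
have sC0 : 0 < (Num.sqrt e)%:C :> R[i] by rewrite ltcR.
have [|s [xs Ss]] := dS (ball x (Num.sqrt e)%:C) _ (ball_open x _).
  by exists x; exact: ballxx.
exists s => //; move: xs; rewrite -ball_normE/= hilbert_norm_lt//.
by rewrite sqr_sqrtr ?ltW// sqnBC.
Qed.

Lemma dense_perp (S : set H) x : dense S -> (forall s, S s -> '[s, x] = 0) -> x = 0.
Proof.
move=> dS Sx; apply: sqn_eq0; apply/eqP; rewrite eq_le sqn_ge0 andbT.
apply/ler_addgt0Pl => e e0; rewrite addr0.
have [s Ss] := dense_sqn x dS e0; rewrite sqnB /rdot Sx//= mulr0 subr0.
by have := sqn_ge0 s; lra.
Qed.

End HilbertTopology.

Lemma closed_graph_cvg (R : realType) (H K : hilbertType R) (A : partial_map H K)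
    (u : nat -> H) (x : H) (y : K) :
  closed_operator A -> (forall n, domain A (u n)) ->
  ip_cvg u x -> ip_cvg (A \o u) y -> domain A x /\ A x = y.
Proof.
move=> cA uA ux uy; suff [Dx yE] : graph A (x, y) by split.
apply: (@closed_cvg _ _ \oo _ (fun n => (u n, A (u n))) _ cA).
  by apply: nearW => n; split => /=.
by apply: cvg_pair; exact: ip_cvg_hilbert.
Qed.

(** * The Hilbert sum of two spaces *)

Section ProductInner.
Context (R : realType) (E F : innerProductType R).

Definition pair_inner (p q : E * F) : R[i] := '[p.1, q.1] + '[p.2, q.2].

Lemma pair_inner_linear q : scalar (pair_inner^~ q).
Proof.
by move=> a p r; rewrite /pair_inner !innerDl !innerZl mulrDr addrACA.
Qed.

Lemma pair_inner_conj p q : pair_inner p q = (pair_inner q p)^*.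
Proof. by rewrite /pair_inner rmorphD; congr (_ + _); exact: innerC. Qed.

Lemma pair_inner_conj_linear p : linear_for (@conjc R \; *%R) (pair_inner p).
Proof.
by move=> a q r /=; rewrite pair_inner_conj pair_inner_linear rmorphD rmorphM/= -!pair_inner_conj.
Qed.

Lemma pair_inner_gt0 p : p != 0 -> 0 < pair_inner p p.
Proof.
case: p => x y; rewrite /pair_inner /= !sqnE -rmorphD ltcR => xy0.
rewrite lt_neqAle addr_ge0 ?sqn_ge0// andbT eq_sym.
apply: contra xy0; rewrite paddr_eq0 ?sqn_ge0// => /andP[/eqP/sqn_eq0-> /eqP/sqn_eq0->].
exact: eqxx.
Qed.

HB.instance Definition _ := bilinear_isBilinear.Build R[i] (E * F)%type (E * F)%type R[i]
  *%R (@conjc R \; *%R) pair_inner (pair_inner_linear, pair_inner_conj_linear).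

Lemma pair_inner_hermitian p q : pair_inner p q = (-1) ^+ false * (pair_inner q p)^*.
Proof. by rewrite expr0 mul1r pair_inner_conj. Qed.

HB.instance Definition _ := isHermitianSesquilinear.Build R[i] (E * F)%type false
  (@conjc R) pair_inner pair_inner_hermitian.

HB.instance Definition _ := isDotProduct.Build R[i] (E * F)%type pair_inner pair_inner_gt0.

HB.instance Definition _ := Lmodule_isInnerProductSpace.Build R (E * F)%type pair_inner.

Lemma inner_pairE (p q : (E * F)%type) : '[p, q] = '[p.1, q.1] + '[p.2, q.2].
Proof. by []. Qed.

Lemma sqn_pairE (p : (E * F)%type) : sqn p = sqn p.1 + sqn p.2.
Proof.
by rewrite /sqn /rdot inner_pairE; case: ('[p.1, _]) ('[p.2, _]) => [a b] [].
Qed.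

Lemma ip_cvg_pair (u : nat -> (E * F)%type) p :
  ip_cvg u p <-> ip_cvg (fst \o u) p.1 /\ ip_cvg (snd \o u) p.2.
Proof.
rewrite /ip_cvg; split=> [up|[u1 u2]]; last first.
  have -> : (fun n => sqn (u n - p)) =
      (fun n => sqn ((fst \o u) n - p.1) + sqn ((snd \o u) n - p.2)).
    by apply/funext => n; rewrite sqn_pairE.
  by rewrite -(addr0 (0 : R)); exact: cvgD.
split; apply: (@squeeze_cvgr _ _ _ _ (fun=> 0) (fun n => sqn (u n - p))) => //;
  try exact: cvg_cst; apply: nearW => n; rewrite sqn_ge0/= sqn_pairE/=.
- by rewrite lerDl sqn_ge0.
- by rewrite lerDr sqn_ge0.
Qed.

Lemma pair_complete : ip_complete E -> ip_complete F -> ip_complete (E * F)%type.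
Proof.
move=> cE cF u uc.
have [|x ux] := cE (fst \o u).
  move=> e /uc[N uN]; exists N => m n Nm Nn.
  by apply: le_trans (uN m n Nm Nn); rewrite sqn_pairE/= lerDl sqn_ge0.
have [|y uy] := cF (snd \o u).
  move=> e /uc[N uN]; exists N => m n Nm Nn.
  by apply: le_trans (uN m n Nm Nn); rewrite sqn_pairE/= lerDr sqn_ge0.
by exists (x, y); apply/ip_cvg_pair.
Qed.

End ProductInner.

(** * Isometries prescribed on a total family, and their adjoints *)

Section Isometries.
Context (R : realType) (E F : innerProductType R).
Hypotheses (cE : ip_complete E) (cF : ip_complete F).

(* The biorthogonal [G] of the pairs [(e i, f i)] in [E * F] is the graph of the
   isometry: for [(p, q)] the projection of [(x, 0)] on [G], totality of [e]
   forces [x = 2 p]. *)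
Lemma isometry_of_total (I : Type) (e : I -> E) (f : I -> F) :
  (forall x, (forall i, '[x, e i] = 0) -> x = 0) ->
  (forall i j, '[e i, e j] = '[f i, f j]) ->
  exists2 V : {linear E -> F}, is_isometry V & forall i, V (e i) = f i.
Proof.
move=> e_total ef.
pose Y : set (E * F)%type := [set q | forall i, '[q, ((e i, f i) : (E * F)%type)] = 0].
pose G : set (E * F)%type := [set p | forall q, Y q -> '[p, q] = 0].
have Gcl : closed_subspace G by exact: closed_subspace_perp.
have [_ GD _] := Gcl.
(* Equality of the Gram matrices puts [(e i, - f i)] in [Y]. In turn [Ge] puts [(q.1, - q.2)] in [Y]
   for every [q] in [G], which is what [Giso] tests against. *)
have Ge p i : G p -> '[p.1, e i] = '[p.2, f i].
  move=> /(_ (e i, - f i)) h; apply/eqP; rewrite -subr_eq0 -innerNr; apply/eqP.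
  by apply: h => j; rewrite inner_pairE/= innerNl ef subrr.
have Giso p q : G p -> G q -> '[p.1, q.1] = '[p.2, q.2].
  move=> /(_ (q.1, - q.2)) h Gq; apply/eqP; rewrite -subr_eq0 -innerNr; apply/eqP.
  by apply: h => j; rewrite inner_pairE/= innerNl (Ge _ _ Gq) subrr.
have Gmem i : G (e i, f i) by move=> q Yq; rewrite innerC Yq rmorph0.
have /choice[V VG] x : exists y, G (x, y).
  have [p Gp pP] := projection_theorem (x, 0) (pair_complete cE cF) Gcl.
  suff -> : x = p.1 + p.1.
    by exists (p.2 + p.2); have := GD 1 p p Gp Gp; rewrite scale1r.
  apply/eqP; rewrite -subr_eq0; apply/eqP/e_total => i.
  have := pP _ (Gmem i); rewrite inner_pairE/= sub0r innerNl -(Ge p i Gp) => h.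
  by rewrite opprD addrA innerBl.
have Vuniq x y : G (x, y) -> y = V x.
  move=> Gxy; apply/eqP; rewrite -subr_eq0; apply/eqP/sqn_eq0.
  have : G (0, V x - y).
    have := GD (-1) _ _ Gxy (VG x).
    by rewrite -[_ *: _ + _]/(-1 *: x + x, -1 *: y + V x) !scaleN1r addNr addrC.
  by move=> g; have := Giso _ _ g g; rewrite /sqn /rdot/= inner0l -[y - _]opprB innerNl innerNr opprK => <-.
have Vlin : linear V by move=> a x y; apply/esym/Vuniq; exact: (GD a _ _ (VG x) (VG y)).
pose V' : {linear E -> F} := HB.pack V (GRing.isLinear.Build _ _ _ _ V Vlin).
exists V' => [x y|i]; first exact/esym/(Giso _ _ (VG x) (VG y)).
by apply/esym/Vuniq.
Qed.

(** Project [(0, y)] on the graph of [V], getting [(p, V p)]. Orthogonality to [(x, V x)] reads <y,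
    V x> = <p, x> + <V p, V x> = 2 <p, x>, so the adjoint sends [y] to [p + p]. *)
Lemma isometry_adjoint (V : {linear E -> F}) : is_isometry V ->
  exists W : {linear F -> E}, is_adjoint V W.
Proof.
move=> Viso.
pose G : set (E * F)%type := [set p | p.2 = V p.1].
have Gcl : closed_subspace G.
  split=> [|a p q|u p uG up].
  - by rewrite /G/= linear0.
  - by rewrite /G/= => -> ->; rewrite linearP.
  - have [u1 u2] := (ip_cvg_pair u p).1 up.
    apply: (ip_cvg_unique u2); move: u1; rewrite /ip_cvg.
    have -> // : (fun n => sqn ((fst \o u) n - p.1)) = (fun n => sqn ((snd \o u) n - V p.1)).
    by apply/funext => n /=; rewrite uG -[V _ - V _]linearB /sqn /rdot Viso.
have /choice[W WP] y : exists w, forall x, '[V x, y] = '[x, w].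
  have [p Gp pP] := projection_theorem (0, y) (pair_complete cE cF) Gcl.
  exists (p.1 + p.1) => x.
  have : '[((0, y) : (E * F)%type) - p, ((x, V x) : (E * F)%type)] = 0 by exact: pP.
  rewrite inner_pairE/= sub0r innerNl innerBl Gp Viso => /eqP.
  rewrite addrCA -opprD subr_eq0 => /eqP yV.
  by rewrite innerC yV -innerDl -innerC.
have Wlin : linear W.
  move=> a y z; apply: innerl_inj => x; rewrite innerC -WP.
  by rewrite innerDr innerZr !WP -innerZr -innerDr -innerC.
by exists (HB.pack_for {linear F -> E} W (GRing.isLinear.Build _ _ _ _ W Wlin)) => x y; exact: WP.
Qed.

End Isometries.

(** * The inverse of 1 + A^* A *)

Section Resolvent.
Context (R : realType) (H K : hilbertType R) (A : partial_map H K).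
Hypotheses (linA : linear_operator A) (closedA : closed_operator A).
Hypothesis (denseA : densely_defined A).

(* [B] is the inverse of [1 + A^* A]; [(B y, A (B y))] is the projection of [(y, 0)]
   on the graph of [A]. *)
Definition is_resolvent (B : {linear H -> H}) : Prop :=
  forall y, domain A (B y) /\
    forall x, domain A x -> '[x, B y] + '[A x, A (B y)] = '[x, y].

(** Closedness of [A] makes its graph a closed subspace of the product. Linearity of [B] comes from
    uniqueness: the difference of two solutions for the same right-hand side has zero norm in the
    graph. *)
Lemma resolvent_exists : exists B, is_resolvent B.
Proof.
have [A0 AD AL] := linA.
pose G : set (H * K)%type := graph A.
have A00 : A 0 = 0 by have := AL (-1) 0 0 A0 A0; rewrite scaler0 addr0 scaleN1r addNr.
have Gcl : closed_subspace G.
  split=> [|a [x x'] [y y'] [/= Dx ->] [/= Dy ->]|u [x y] uG].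
  - by split => //=.
  - by split => /=; [exact: AD|rewrite AL].
  - move=> /ip_cvg_pair[/= u1 u2].
    have [||Dx Ax] := closed_graph_cvg (u := fst \o u) (y := y) closedA _ u1.
    + by move=> n; case: (uG n).
    + have -> // : A \o (fst \o u) = snd \o u.
      by apply/funext => n /=; case: (uG n).
    + by split => /=.
have /choice[B BP] y : exists b, domain A b /\
    forall x, domain A x -> '[x, b] + '[A x, A b] = '[x, y].
  have cHK := pair_complete (@hilbert_complete R H) (@hilbert_complete R K).
  have [[b c] [/= Db cE] bP] := projection_theorem (y, 0) cHK Gcl.
  exists b; split => // x Dx.
  have : '[((y, 0) : (H * K)%type) - (b, c), ((x, A x) : (H * K)%type)] = 0.
    by apply: bP; split.
  rewrite inner_pairE/= sub0r innerNl innerBl cE => /eqP.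
  by rewrite -addrA -opprD subr_eq0 => /eqP h; rewrite innerC [X in _ + X]innerC [RHS]innerC -rmorphD h.
have Blin : linear B.
  move=> a y z; have [Dy yP] := BP y; have [Dz zP] := BP z.
  have [Dyz yzP] := BP (a *: y + z).
  set b := B _; pose c := a *: B y + B z.
  have Dc : domain A c by exact: AD.
  have Dd : domain A (b - c) by rewrite addrC -scaleN1r; exact: AD.
  have Ad : A (b - c) = A b - A c by rewrite addrC -scaleN1r AL// scaleN1r addrC.
  apply/eqP; rewrite -subr_eq0; apply/eqP/sqn_eq0.
  have e1 := yzP _ Dd.
  have e2 : '[b - c, c] + '[A (b - c), A c] = '[b - c, a *: y + z].
    rewrite /c AL// !innerDr !innerZr addrACA -mulrDr.
    by rewrite (yP _ Dd) (zP _ Dd).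
  have : '[b - c, b - c] + '[A (b - c), A (b - c)] = 0.
    rewrite [X in _ + '[_, X]]Ad !innerBr addrACA -opprD e2; apply/eqP; rewrite subr_eq0; exact/eqP.
  rewrite !sqnE -rmorphD => /(congr1 (@complex.Re R))/= /eqP.
  by rewrite paddr_eq0 ?sqn_ge0// => /andP[/eqP-> _].
by exists (HB.pack_for {linear H -> H} B (GRing.isLinear.Build _ _ _ _ B Blin)) => y; exact: BP.
Qed.

Variable B : {linear H -> H}.
Hypothesis BP : is_resolvent B.

Lemma resolvent_selfadjoint x y : '[B x, y] = '[x, B y].
Proof.
rewrite -(BP y).2; last exact: (BP x).1.
rewrite [RHS]innerC -(BP x).2; last exact: (BP y).1.
by rewrite rmorphD; congr (_ + _); exact: innerC.
Qed.

Lemma resolvent_energy x y : '[A (B x), A (B y)] = '[B x, y] - '[B x, B y].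
Proof.
rewrite -(BP y).2; last exact: (BP x).1.
by rewrite [RHS]addrAC subrr add0r.
Qed.

(** If [B x = 0], the defining identity makes [x] orthogonal to the whole domain. This is where
    density of the domain enters. *)
Lemma resolvent_inj x : B x = 0 -> x = 0.
Proof.
have [A0 _ AL] := linA.
have A00 : A 0 = 0 by have := AL (-1) 0 0 A0 A0; rewrite scaler0 addr0 scaleN1r addNr.
move=> Bx0; apply: (dense_perp denseA) => s Ds.
by rewrite -(BP x).2// Bx0 A00 !inner0r addr0.
Qed.

(** The component of a vector orthogonal to the range of [V] will be fixed by [B]; this lemma shows
    that it always lies in the domain and contributes nothing to [A]. *)
Lemma resolvent_fixed x : B x = x -> domain A x /\ A x = 0.
Proof.
move=> Bx; split; first by rewrite -Bx; exact: (BP x).1.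
have := resolvent_energy x x; rewrite Bx subrr => /eqP.
by rewrite sqnE => /eqP/(congr1 (@complex.Re R))/= /sqn_eq0.
Qed.

End Resolvent.

(** * Completeness of L2 *)

(** The increments are at most [Num.sqrt C * 2^-1 ^+ n] in absolute value, so they form an
    absolutely convergent series. *)
Lemma cvg_of_square_increments (R : realType) (a : nat -> R) (C : R) :
  (forall n, 4 ^+ n * (a n.+1 - a n) ^+ 2 <= C) -> cvgn a.
Proof.
move=> aC; have C0 : 0 <= C.
  by apply: le_trans (aC 0%N); rewrite expr0 mul1r sqr_ge0.
have -> : a = (fun n => a 0%N + series (telescope a) n).
  by apply/funext => n; exact: eq_sum_telescope.
apply: is_cvgD; first exact: is_cvg_cst.
apply: normed_cvg; apply: (@series_le_cvg _ _ (geometric (Num.sqrt C) 2^-1)).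
- by move=> n; exact: normr_ge0.
- by move=> n; rewrite /geometric/= mulr_ge0 ?sqrtr_ge0// exprn_ge0.
- move=> n; rewrite /telescope /geometric/=.
  rewrite -(@ler_pXn2r _ 2)// ?nnegrE ?mulr_ge0 ?sqrtr_ge0 ?exprn_ge0//.
  rewrite real_normK ?num_real// exprMn sqr_sqrtr// -exprM mulnC exprM.
  rewrite (_ : 2^-1 ^+ 2 = 4^-1 :> R); last by field.
  by rewrite exprVn ler_pdivlMr ?exprn_gt0// mulrC.
by apply: is_cvg_geometric_series; rewrite ger0_norm; lra.
Qed.

Section L2Norm.
Context d (M : measurableType d) (R : realType) (mu : {measure set M -> \bar R}).
Implicit Types (f g : L2 mu) (h : M -> R[i]).

Lemma L2_sqnE f : (sqn f)%:E = (\int[mu]_x (sqr_modulus (repr f) x)%:E)%E.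
Proof.
have fi := integrable_sqr_modulus (L2fun_square_integrable (repr f)).
rewrite -[RHS]fineK; last exact: integrable_fin_num.
congr EFin; apply: eq_Rintegral => x _; rewrite /sqr_modulus.
by case: (repr f x) => a b /=; rewrite mulrN opprK -!expr2.
Qed.

Lemma L2_sqn_ae f h : cmeasurable h -> {ae mu, forall x, repr f x = h x} ->
  (sqn f)%:E = (\int[mu]_x (sqr_modulus h x)%:E)%E.
Proof.
move=> mh fh; rewrite L2_sqnE; apply: ae_eq_integral => //.
- by apply/measurable_EFinP/measurable_sqr_modulus/L2fun_cmeasurable.
- exact/measurable_EFinP/measurable_sqr_modulus.
- by apply: filterS fh => x + _; rewrite /sqr_modulus => ->.
Qed.

Lemma L2_repr_sub f g : {ae mu, forall x, repr (f - g) x = repr f x - repr g x}.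
Proof.
rewrite addrC -scaleN1r; apply: filterS (L2_repr_linear (-1) g f) => x ->.
by rewrite mulN1r addrC.
Qed.

Lemma cmeasurableB (h k : M -> R[i]) : cmeasurable h -> cmeasurable k ->
  cmeasurable (fun x => h x - k x).
Proof.
move=> mh mk; have -> : (fun x => h x - k x) = h + (fun x => (-1) * k x).
  by apply/funext => x; rewrite fctE mulN1r.
by apply: cmeasurableD => //; apply: cmeasurableM => //; exact: cmeasurable_cst.
Qed.

Lemma square_integrableB (h k : M -> R[i]) : square_integrable mu h ->
  square_integrable mu k -> square_integrable mu (fun x => h x - k x).
Proof.
move=> hi ki; have -> : (fun x => h x - k x) = -1 *: k + h.
  by apply/funext => x; rewrite !fctE /= -[_ *: _]/(-1 * k x) mulN1r addrC.
by apply/L2fun_predP; apply: (L2fun_submod_closed mu).2; exact/L2fun_predP.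
Qed.

(* A sequence with [sqn (u (phi j.+1) - u (phi j)) <= 8 ^- j] converges almost
   everywhere, because [sum_j 4 ^ j |u (phi j.+1) - u (phi j)| ^ 2] is integrable. *)
Lemma L2_ae_cvg_subsequence (u : nat -> L2 mu) : ip_cauchy u ->
  exists (phi : nat -> nat) (g : M -> R[i]), [/\ forall N, \forall n \near \oo, (N <= phi n)%N,
    cmeasurable g &
    {ae mu, forall x,
      ((fun n => complex.Re (repr (u (phi n)) x)) @ \oo --> complex.Re (g x)) /\
      ((fun n => complex.Im (repr (u (phi n)) x)) @ \oo --> complex.Im (g x))}].
Proof.
move=> uc.
have /choice[N NP] (j : nat) : exists N, forall m n, (N <= m)%N -> (N <= n)%N ->
    sqn (u m - u n) <= 8 ^- j.
  by apply: uc; rewrite invr_gt0 exprn_gt0.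
(* The summand [n] makes [phi] tend to infinity. The maximum puts both [phi n] and [phi n.+1] beyond
   [N n]. *)
pose phi n := (n + \max_(i < n.+1) N i)%N.
have phiN n : (N n <= phi n)%N.
  by apply: leq_trans (leq_addl _ _); apply: (@leq_bigmax _ (fun i : 'I_n.+1 => N i) ord_max).
have phiS n : (N n <= phi n.+1)%N.
  apply: leq_trans (leq_addl _ _).
  exact: (@leq_bigmax _ (fun i : 'I_n.+2 => N i) (widen_ord (leqnSn n.+1) ord_max)).
pose D (n : nat) (x : M) : R := sqr_modulus (fun y => repr (u (phi n.+1)) y - repr (u (phi n)) y) x.
have Dm n : cmeasurable (fun y => repr (u (phi n.+1)) y - repr (u (phi n)) y).
  by apply: cmeasurableB; exact: L2fun_cmeasurable.
have D8 n : (\int[mu]_x (D n x)%:E <= (8 ^- n)%:E)%E.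
  rewrite -(@L2_sqn_ae (u (phi n.+1) - u (phi n))) ?lee_fin//; last exact: L2_repr_sub.
  exact: NP.
pose S (x : M) : \bar R := (\sum_(0 <= n <oo) (4 ^+ n * D n x)%:E)%E.
have mD n : measurable_fun [set: M] (fun x => (4 ^+ n * D n x)%:E).
  apply/measurable_EFinP; apply: measurable_funM; first exact: measurable_cst.
  exact: measurable_sqr_modulus.
have D0 n x : (0 <= (4 ^+ n * D n x)%:E)%E.
  by rewrite lee_fin mulr_ge0// ?exprn_ge0// sqr_modulus_ge0.
have mS : measurable_fun [set: M] S by exact: ge0_emeasurable_sum.
have S0 x : (0 <= S x)%E by exact: nneseries_ge0.
have intS : mu.-integrable [set: M] S.
  apply/integrableP; split => //.
  under eq_integral do rewrite gee0_abs//.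
  rewrite integral_nneseries//.
  apply: (@le_lt_trans _ _ (\sum_(0 <= n <oo) (2 ^- n)%:E)%E); last first.
    apply: (@le_lt_trans _ _ 2%:E); last exact: ltry.
    apply: lime_le; first by apply: is_cvg_nneseries => k _ _; rewrite lee_fin invr_ge0 exprn_ge0.
    apply: nearW => n; rewrite sumEFin lee_fin.
    suff -> : \sum_(0 <= i < n) 2 ^- i = 2 - 2 * 2 ^- n :> R.
      by rewrite lerBlDr lerDl mulr_ge0// invr_ge0 exprn_ge0.
    elim: n => [|n IH]; first by rewrite big_nil expr0 invr1 mulr1 subrr.
    by rewrite big_nat_recr//= IH exprS invfM; field; rewrite expf_neq0.
  apply: lee_nneseries => [n _ _|n _]; first by apply: integral_ge0 => x _; exact: D0.
  under eq_integral do rewrite EFinM.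
  rewrite ge0_integralZl//.
  - apply: le_trans (lee_wpmul2l _ (D8 n)) _; first by rewrite lee_fin exprn_ge0.
    by rewrite -EFinM lee_fin -exprVn -exprMn (_ : 4 / 8 = 2^-1 :> R) ?exprVn//; field.
  - by apply/measurable_EFinP; exact: measurable_sqr_modulus.
  - by move=> x _; rewrite lee_fin sqr_modulus_ge0.
(* The upper limit is measurable without any convergence assumption and equals the limit where there
   is one; elsewhere its value is irrelevant. *)
pose g x := (fine (limn_esup (fun n => (complex.Re (repr (u (phi n)) x))%:E)) +i*
             fine (limn_esup (fun n => (complex.Im (repr (u (phi n)) x))%:E))).
exists phi, g; split.
- move=> k; exists k => // n /= kn; exact: leq_trans kn (leq_addr _ _).
- split => /=.
    apply: measurableT_comp => //; apply: measurable_fun_limn_esup => n.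
    by apply/measurable_EFinP; exact: (L2fun_cmeasurable (repr (u (phi n)))).1.
  apply: measurableT_comp => //; apply: measurable_fun_limn_esup => n.
  by apply/measurable_EFinP; exact: (L2fun_cmeasurable (repr (u (phi n)))).2.
have limE (a : nat -> R) : cvgn a -> a @ \oo --> fine (limn_esup (EFin \o a)).
  move=> ca; have : (EFin \o a) @ \oo --> (limn a)%:E by apply/cvg_EFin => //; exact: nearW.
  by move=> /cvg_limn_einf_sup[_ ->].
have := integrable_ae measurableT intS; apply: filterS => x /(_ Logic.I) Sfin.
have DS n : 4 ^+ n * D n x <= fine (S x).
  rewrite -lee_fin fineK//; apply: le_trans (nneseries_lim_ge n.+1 _); last by [].
  by rewrite big_nat_recr//= leeDr// sume_ge0.
split; apply: limE; apply: (@cvg_of_square_increments _ _ (fine (S x))) => n; apply: le_trans (DS n);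
  rewrite ler_pM2l ?exprn_gt0// /D /sqr_modulus;
  case: (repr (u (phi n.+1)) x) (repr (u (phi n)) x) => [a b] [a' b'] /=.
- by rewrite lerDl sqr_ge0.
- by rewrite lerDr sqr_ge0.
Qed.

(** Fatou's lemma along the almost everywhere convergent subsequence bounds the distance from [u m]
    to [g] by the Cauchy bound. The same estimate with bound 1 shows that [g] is
    square-integrable. *)
Lemma L2_complete : ip_complete (L2 mu).
Proof.
move=> u uc; have [phi [g [phi_oo mg gP]]] := L2_ae_cvg_subsequence uc.
have bound e N : (forall m n, (N <= m)%N -> (N <= n)%N -> sqn (u m - u n) <= e) ->
    forall m, (N <= m)%N ->
    (\int[mu]_x (sqr_modulus (fun y => repr (u m) y - g y) x)%:E <= e%:E)%E.
  move=> Ne m Nm.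
  pose F n x := (sqr_modulus (fun y => repr (u m) y - repr (u (phi n)) y) x)%:E.
  have mF n : cmeasurable (fun y => repr (u m) y - repr (u (phi n)) y).
    by apply: cmeasurableB; exact: L2fun_cmeasurable.
  have mF' n : measurable_fun [set: M] (F n).
    exact/measurable_EFinP/measurable_sqr_modulus.
  have mG : measurable_fun [set: M] (fun x => (sqr_modulus (fun y => repr (u m) y - g y) x)%:E).
    apply/measurable_EFinP/measurable_sqr_modulus/cmeasurableB => //.
    exact: L2fun_cmeasurable.
  have -> : (\int[mu]_x (sqr_modulus (fun y => repr (u m) y - g y) x)%:E =
      \int[mu]_x limn_einf (F^~ x))%E.
    apply: ae_eq_integral => //.
      apply: measurableT_comp => //.
      by apply: measurable_fun_limn_esup => n; exact: measurableT_comp.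
    apply: filterS gP => x [gr gi] _.
    apply/esym; apply: (cvg_limn_einf_sup _).1.
    apply/cvg_EFin; first exact: nearW.
    rewrite /F /sqr_modulus /comp /=.
    case: (g x) gr gi => a b /= gr gi.
    have sub c (w : nat -> R) l : w @ \oo --> l -> (fun n => (c - w n) ^+ 2) @ \oo --> (c - l) ^+ 2.
      move=> wl; rewrite expr2; under eq_fun do rewrite expr2.
      by apply: cvgM; apply: cvgB => //; exact: cvg_cst.
    case: (repr (u m) x) => c1 c2 /=; apply: cvg_trans (cvgD (sub c1 _ _ gr) (sub c2 _ _ gi)).
    apply: near_eq_cvg; apply: nearW => n /=.
    by rewrite fctE; case: (repr (u (phi n)) x).
  apply: le_trans (fatou mu measurableT mF' _) _.
    by move=> n x _; rewrite lee_fin sqr_modulus_ge0.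
  rewrite limn_einf_lim; apply: lime_le; first exact: is_cvg_einfs.
  have := phi_oo N; apply: filterS => n Nn.
  apply: (@le_trans _ _ (\int[mu]_x F n x)%E); first by apply: ereal_inf_lbound; exists n => /=.
  rewrite -(@L2_sqn_ae (u m - u (phi n))) ?lee_fin//; last exact: L2_repr_sub.
  exact: Ne.
have [N1 N1P] := uc 1 ltr01.
have gi : square_integrable mu g.
  have -> : g = (fun x => repr (u N1) x - (repr (u N1) x - g x)).
    by apply/funext => x; rewrite subKr.
  apply: square_integrableB; first exact: L2fun_square_integrable.
  split; first by apply: cmeasurableB => //; exact: L2fun_cmeasurable.
  exact: le_lt_trans (bound 1 _ N1P _ (leqnn _)) (ltry _).
exists (in_L2 mu g); apply/cvgr0Pnorm_le => e /uc[N NP].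
exists N => // m /= Nm; rewrite ger0_norm ?sqn_ge0//.
rewrite -lee_fin (@L2_sqn_ae _ (fun x => repr (u m) x - g x)); last 2 first.
- by apply: cmeasurableB => //; exact: L2fun_cmeasurable.
- by apply: filterS2 (L2_repr_sub (u m) (in_L2 mu g)) (in_L2_ae gi) => x -> ->.
exact: bound NP _ Nm.
Qed.

End L2Norm.

(** * The Hausdorff moment problem *)

(** By compactness the image filter has a cluster point, and an ultrafilter converges to its cluster
    points. One ultrafilter gives limits at all reals at once, in place of Helly's selection by
    diagonal extraction. *)
Lemma ultra_bounded_cvg (R : realType) (U : set_system nat) (s : nat -> R) (C : R) :
  UltraFilter U -> (forall n, `|s n| <= C) -> exists l : R, s @ U --> l.
Proof.
move=> UU sC.
have FU : ProperFilter (s @ U) by exact: fmap_proper_filter.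
have [l [_ sl]] : `[- C, C]%classic `&` cluster (s @ U) !=set0.
  apply: (@segment_compact _ (- C) C (s @ U) FU).
  by apply: (@filterE _ U) => n /=; rewrite in_itv/= -ler_norml.
exists l => A lA.
have [//|UcA] := in_ultra_setVsetC (s @^-1` A) UU.
have [x [cAx Ax]] := sl (~` A) A UcA lA.
by case: cAx.
Qed.

Lemma norm_subX_le (R : realType) (x y : R) (m : nat) : `|x| <= 1 -> `|y| <= 1 ->
  `|x ^+ m - y ^+ m| <= m%:R * `|x - y|.
Proof.
move=> x1 y1; rewrite subrXX normrM mulrC ler_wpM2r//.
apply: le_trans (ler_norm_sum _ _ _) _.
rewrite -[leRHS]mulr1 mulr_natl -[X in _ *+ X](card_ord m) -sumr_const.
by apply: ler_sum => i _; rewrite normrM !normrX mulr_ile1// exprn_ile1.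
Qed.

Section Cells.
Context (R : realType) (T : nat -> R).
Hypothesis T_nd : {homo T : i j / (i <= j)%N >-> i <= j}.

Definition in_cell (i : nat) (x : R) : bool := (T i < x) && (x <= T i.+1).

(** The cells are disjoint and cover []T 0, T n]], so the sum reduces to the value [g i] of the
    single cell containing [x]. It serves both for sums over Bernstein nodes and for integrals of
    step functions. *)
Lemma cells_approx (g : nat -> R) (n : nat) (x y delta : R) :
  (forall i, (i < n)%N -> in_cell i x -> `|y - g i| <= delta) ->
  T 0%N < x -> x <= T n -> `|y - \sum_(i < n) g i * (in_cell i x)%:R| <= delta.
Proof.
elim: n => [|n IH] gP T0x xTn; first by have := lt_le_trans T0x xTn; rewrite ltxx.
rewrite big_ord_recr/=; have [xn|nx] := leP x (T n).
  rewrite {2}/in_cell ltNge xn/= mulr0 addr0; apply: IH => // i ilt.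
  by apply: gP; rewrite ltnS ltnW.
rewrite big1 ?add0r => [|i _]; last first.
  have ix : T i.+1 < x by apply: le_lt_trans nx; exact: T_nd.
  by rewrite /in_cell (leNgt x) ix andbF mulr0.
have cn : in_cell n x by rewrite /in_cell nx.
by rewrite cn mulr1; exact: gP.
Qed.

End Cells.

Section HausdorffMoments.
Context (R : realType).
Implicit Types (a : nat -> nat -> R).

(* [a k l] plays the role of the integral of [t ^ k * (1 - t) ^ l]. *)
Definition moment_array a : Prop :=
  (forall k l, 0 <= a k l) /\ (forall k l, a k l = a k.+1 l + a k l.+1).

(** The integral of the Bernstein polynomial of index [k] and degree [n.+1]; the degree is shifted
    so that the denominator in [bnode] is never 0. *)
Definition bweight a (n k : nat) : R := 'C(n.+1, k)%:R * a k (n.+1 - k)%N.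

Definition bnode (n k : nat) : R := k%:R / n.+1%:R.

Definition bsum a (n : nat) (f : R -> R) : R :=
  \sum_(k < n.+2) bweight a n k * f (bnode n k).

Lemma bweight_ge0 a n k : moment_array a -> 0 <= bweight a n k.
Proof. by move=> [a0 _]; rewrite mulr_ge0. Qed.

Lemma moment_array_shift a : moment_array a -> moment_array (fun k => a k.+1).
Proof. by move=> [a0 aD]; split => k l; [exact: a0|exact: aD]. Qed.

(** For the moments of a measure this is the expansion of [1 = (t + (1 - t)) ^ r] under the
    integral. With [m = s = 0] it shows that the Bernstein weights add up to the total mass. *)
Lemma moment_array_binomial a r m s : moment_array a ->
  a m s = \sum_(j < r.+1) 'C(r, j)%:R * a (m + j)%N (s + (r - j))%N.
Proof.
move=> [_ aD]; elim: r m s => [|r IH] m s.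
  by rewrite big_ord1 /= bin0 mul1r subn0 !addn0.
rewrite aD (IH m.+1 s) (IH m s.+1) [RHS]big_ord_recl /= bin0 mul1r addn0 subn0.
under [in RHS]eq_bigr => j _.
  rewrite /bump/= add1n binS natrD mulrDl subSS addnS -addSn. over.
rewrite big_split/= addrA addrC; congr (_ + _).
rewrite [LHS]big_ord_recl [in RHS]big_ord_recr/= bin0 mul1r addn0 subn0.
rewrite bin_small// mul0r addr0 addSnnS; congr (_ + _).
by apply: eq_bigr => j _; congr (_ * a _ _); have := ltn_ord j; rewrite /bump/=; lia.
Qed.

Lemma sum_bweight a n : moment_array a -> \sum_(k < n.+2) bweight a n k = a 0%N 0%N.
Proof.
move=> aP; rewrite (moment_array_binomial n.+1 0 0 aP).
by apply: eq_bigr => k _; rewrite !add0n.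
Qed.

Lemma bnode_itv n k : (k < n.+2)%N -> 0 <= bnode n k <= 1.
Proof.
by move=> kn; rewrite /bnode divr_ge0//= ler_pdivrMr// mul1r ler_nat -ltnS.
Qed.

Lemma norm_bnode n k : (k < n.+2)%N -> `|bnode n k| <= 1.
Proof. by move=> /bnode_itv/andP[x0 x1]; rewrite ger0_norm. Qed.

(* [k / (n + 2)] times the weight of [k] for [a] is the weight of [k - 1] for the
   shifted array. *)
Lemma bsum_shift a n (f : R -> R) :
  bsum a n.+1 (fun x => x * f x) =
  \sum_(k < n.+2) bweight (fun k => a k.+1) n k * f (bnode n.+1 k.+1).
Proof.
rewrite /bsum big_ord_recl/= [X in X * f _](mul0r _ : bnode _ 0 = 0) mul0r mulr0 add0r.
apply: eq_bigr => k _; rewrite /bump/= add1n mulrA; congr (_ * _).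
rewrite /bweight subSS /bnode mulrAC; congr (_ * _).
apply: (@mulIf _ n.+2%:R); first by rewrite pnatr_eq0.
rewrite mulrA mulfVK ?pnatr_eq0// -!natrM.
by rewrite mulnC -mul_bin_diag mulnC.
Qed.

(** Induction on [m] over all arrays: [bsum_shift] trades a factor [x] for a shift of the array, at
    the price of moving the nodes from [k / (n + 1)] to [(k + 1) / (n + 2)]. This displacement is at
    most [1 / (n + 1)]. *)
Lemma bsum_cvg a m : moment_array a ->
  (fun n => bsum a n (fun x => x ^+ m)) @ \oo --> a m 0%N.
Proof.
elim: m a => [|m IH] a aP.
  have -> : (fun n => bsum a n (fun x => x ^+ 0)) = (fun=> a 0%N 0%N).
    apply/funext => n; rewrite -(sum_bweight n aP).
    by apply: eq_bigr => k _; rewrite expr0 mulr1.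
  exact: cvg_cst.
have a'P := moment_array_shift aP; pose a' := fun k => a k.+1.
rewrite -cvg_shiftS /=.
have diff n : `|bsum a n.+1 (fun x => x ^+ m.+1) - bsum a' n (fun x => x ^+ m)|
    <= (a' 0%N 0%N * m%:R) * n.+1%:R^-1.
  have -> : bsum a n.+1 (fun x => x ^+ m.+1) = bsum a n.+1 (fun x => x * x ^+ m).
    by apply: eq_bigr => k _; rewrite exprS.
  rewrite bsum_shift /bsum -sumrB -(sum_bweight n a'P : _ = a' 0%N 0%N) !mulr_suml.
  apply: le_trans (ler_norm_sum _ _ _) _; apply: ler_sum => k _.
  rewrite -mulrBr normrM (ger0_norm (bweight_ge0 _ _ a'P)) -[leRHS]mulrA.
  apply: ler_wpM2l; first exact: (bweight_ge0 _ _ a'P).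
  apply: le_trans (norm_subX_le _ (norm_bnode _) (norm_bnode _)) _ => //.
    by rewrite ltnS.
  apply: ler_wpM2l => //.
  have kn : (k%:R <= n.+1%:R :> R) by rewrite ler_nat -ltnS.
  have n0 : 0 < n.+1%:R :> R by [].
  rewrite /bnode -[n.+2%:R]natr1 -[(val k).+1%:R]natr1; set N := n.+1%:R in kn n0 *; set x := k%:R in kn *.
  have x0 : 0 <= x by [].
  have -> : (x + 1) / (N + 1) - x / N = (N - x) / (N * (N + 1)).
    by field; rewrite !gt_eqF//; lra.
  rewrite ger0_norm; last by rewrite divr_ge0 ?subr_ge0// mulr_ge0; lra.
  rewrite ler_pdivrMr; last by rewrite mulr_gt0; lra.
  by rewrite mulrA mulVf ?gt_eqF//; lra.
have h0 : (fun n => a' 0%N 0%N * m%:R * n.+1%:R^-1 : R) @ \oo --> (0 : R).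
  move: (a' 0%N 0%N * m%:R) => c.
  by rewrite -[X in _ --> X](mulr0 c); apply: cvgMl_tmp; exact: cvg_harmonic.
have e0 : (fun n => bsum a n.+1 (fun x => x ^+ m.+1) - bsum a' n (fun x => x ^+ m)) @ \oo --> (0 : R).
  apply: norm_cvg0; apply: (@squeeze_cvgr _ _ _ _ (fun=> 0) (fun n => (a' 0%N 0%N * m%:R) * n.+1%:R^-1)).
  - by apply: nearW => n; rewrite normr_ge0 diff.
  - exact: cvg_cst.
  - exact: h0.
rewrite (_ : (fun n => bsum a n.+1 _) = (fun n => (bsum a n.+1 (fun x => x ^+ m.+1) -
    bsum a' n (fun x => x ^+ m)) + bsum a' n (fun x => x ^+ m))); last first.
  by apply/funext => n; rewrite subrK.
by rewrite -[a m.+1 0%N]add0r; exact: cvgD e0 (IH a' a'P).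
Qed.

End HausdorffMoments.

Section FiniteMeasureIntegrals.
Context d (T : measurableType d) (R : realType) (nu : {finite_measure set T -> \bar R}).
Implicit Types (f : T -> R).

Lemma bounded_integrable f (C : R) : measurable_fun [set: T] f ->
  (forall x, `|f x| <= C) -> nu.-integrable [set: T] (EFin \o f).
Proof.
move=> mf fC; apply: (@le_integrable _ _ _ nu _ _ _ (EFin \o cst C)) => //.
- exact/measurable_EFinP.
- by move=> x _; rewrite /= lee_fin (le_trans (fC x))// ler_norm.
- exact: finite_measure_integrable_cst.
Qed.

Lemma measurable_indic_sum (c : nat -> R) (A : nat -> set T) n :
  (forall i, measurable (A i)) ->
  measurable_fun [set: T] (fun x => \sum_(i < n) c i * \1_(A i) x).
Proof.
move=> mA; elim: n => [|n IH].
  by under eq_fun do rewrite big_ord0; exact: measurable_cst.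
under eq_fun do rewrite big_ord_recr/=.
apply: measurable_funD => //; apply: measurable_funM; first exact: measurable_cst.
exact: measurable_indic.
Qed.

Lemma norm_indic_sum_le (c : nat -> R) (A : nat -> set T) n x :
  `|\sum_(i < n) c i * \1_(A i) x| <= \sum_(i < n) `|c i|.
Proof.
apply: le_trans (ler_norm_sum _ _ _) _; apply: ler_sum => i _.
by rewrite normrM ler_piMr// indicE; case: (_ \in _); rewrite ?normr1 ?normr0.
Qed.

Lemma Rintegral_indic_sum (c : nat -> R) (A : nat -> set T) n :
  (forall i, measurable (A i)) ->
  \int[nu]_x (\sum_(i < n) c i * \1_(A i) x) = \sum_(i < n) c i * fine (nu (A i)).
Proof.
move=> mA; elim: n => [|n IH].
  by rewrite big_ord0; under eq_Rintegral do rewrite big_ord0; rewrite Rintegral_cst// mul0r.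
rewrite big_ord_recr/=; under eq_Rintegral do rewrite big_ord_recr/=.
have iA : nu.-integrable [set: T] (EFin \o (\1_(A n) : T -> R)).
  apply: (@bounded_integrable _ 1); first exact: measurable_indic.
  by move=> x; rewrite indicE; case: (_ \in _); rewrite ?normr1 ?normr0.
rewrite RintegralD//.
- rewrite IH RintegralZl//; congr (_ + _ * _); rewrite /Rintegral; congr fine.
  by rewrite integral_indic// setIT.
- apply: bounded_integrable; first exact: measurable_indic_sum.
  by move=> x; exact: norm_indic_sum_le.
- apply: (@bounded_integrable _ `|c n|).
    by apply: measurable_funM; [exact: measurable_cst|exact: measurable_indic].
  move=> x; rewrite normrM ler_piMr// indicE.
  by case: (_ \in _); rewrite ?normr1 ?normr0.
Qed.

End FiniteMeasureIntegrals.

(** * Right-continuous regularization of a nondecreasing function *)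

Section RightRegularization.
Context (R : realType) (G : R -> R) (c : R).
Hypothesis G_nd : {homo G : x y / x <= y}.
Hypothesis G_ge0 : forall x, 0 <= G x.

(** A pointwise limit of distribution functions need not be right-continuous, as a
    Lebesgue-Stieltjes measure demands. *)
Definition right_reg (x : R) : R := inf [set G y | y in `]x, +oo[%classic].

Let has_inf_reg x : has_inf [set G y | y in `]x, +oo[%classic].
Proof.
split; last by exists 0 => _ [y _ <-].
by exists (G (x + 1)), (x + 1); rewrite //= in_itv/= andbT ltrDl.
Qed.

Lemma right_reg_le x y : x < y -> right_reg x <= G y.
Proof.
by move=> xy; apply: (inf_lbound (has_inf_reg x).2); exists y; rewrite //= in_itv/= andbT.
Qed.

Lemma right_reg_ge x : G x <= right_reg x.
Proof.
apply: lb_le_inf; first exact: (has_inf_reg x).1.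
move=> _ [y xy <-]; apply/G_nd/ltW.
by move: xy; rewrite /= in_itv/= andbT.
Qed.

Lemma right_reg_adherent x e : 0 < e -> exists2 y, x < y & G y < right_reg x + e.
Proof.
move=> e0; have [_ [y xy <-] ye] := inf_adherent e0 (has_inf_reg x).
by exists y => //; move: xy; rewrite /= in_itv/= andbT.
Qed.

Lemma right_reg_nd : {homo right_reg : x y / x <= y}.
Proof.
move=> x y xy; apply: lb_le_inf; first exact: (has_inf_reg y).1.
move=> _ [z yz <-]; apply: right_reg_le; apply: le_lt_trans xy _.
by move: yz; rewrite /= in_itv/= andbT.
Qed.

Lemma right_reg_cvg x : G (x + e) @[e --> 0^'+] --> right_reg x.
Proof.
apply/cvgrPdistC_le => e e0; have [y xy Gy] := right_reg_adherent x e0.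
have yx : 0 < y - x by rewrite subr_gt0.
near=> t; have t0 : 0 < t by near: t; exact: nbhs_right_gt.
have ty : t < y - x by near: t; exact: nbhs_right_lt.
rewrite ger0_norm ?subr_ge0; last by apply: right_reg_le; rewrite ltrDl.
rewrite lerBlDl; apply: le_trans (ltW Gy); apply: G_nd.
by rewrite addrC -lerBrDr ltW.
Unshelve. all: by end_near. Qed.

Lemma right_reg_right_continuous : right_continuous right_reg.
Proof.
move=> x; apply/cvgrPdistC_le => e e0; have [y xy Gy] := right_reg_adherent x e0.
near=> t; have xt : x < t by near: t; exact: nbhs_right_gt.
have ty : t < y by near: t; exact: nbhs_right_lt.
rewrite ger0_norm ?subr_ge0; last exact/right_reg_nd/ltW.
by rewrite lerBlDl; apply: le_trans (ltW Gy); exact: right_reg_le.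
Unshelve. all: by end_near. Qed.

End RightRegularization.

(** The measures live on the whole line but are carried by [0, 1]. Composing with [clip] makes
    powers and polynomials bounded everywhere without changing them on [0, 1]. *)
Definition clip (R : realType) (x : R) : R := Num.min 1 (Num.max 0 x).

Lemma clip_itv (R : realType) (x : R) : 0 <= clip x <= 1.
Proof. by rewrite /clip le_min ler01 le_max lexx/= ge_min lexx. Qed.

Lemma norm_clip (R : realType) (x : R) : `|clip x| <= 1.
Proof. by have /andP[c0 c1] := clip_itv x; rewrite ger0_norm. Qed.

Lemma clip_id (R : realType) (x : R) : 0 <= x <= 1 -> clip x = x.
Proof. by move=> /andP[x0 x1]; rewrite /clip (max_idPr x0) (min_idPr x1). Qed.

Lemma clip_lipschitz (R : realType) (x y : R) : `|clip x - clip y| <= `|x - y|.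
Proof.
wlog xy : x y / x <= y => [h|].
  by have [/h//|/ltW/h] := leP x y; rewrite distrC (distrC y).
rewrite (distrC x) (ger0_norm (_ : 0 <= y - x)) ?subr_ge0//.
rewrite /clip ler_norml; case: (leP 0 x) (leP 0 y) => x0 [] y0;
  rewrite /Num.min; repeat case: ifP => //; rewrite ?ltNge => *; apply/andP; split; lra.
Qed.

Lemma clip_continuous (R : realType) : continuous (@clip R).
Proof.
move=> x; apply/cvgrPdist_le => e e0; near=> y.
apply: le_trans (clip_lipschitz _ _) _; near: y.
by move: e e0; apply/cvgrPdist_le; exact: cvg_id.
Unshelve. all: by end_near. Qed.

Section HausdorffMeasure.
Context (R : realType) (a : nat -> nat -> R).
Hypothesis aP : moment_array a.
Let c := a 0%N 0%N.

Let Gn (n : nat) (x : R) : R := \sum_(k < n.+2) bweight a n k * (bnode R n k <= x)%R%:R.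

Let Gn_nd n : {homo Gn n : x y / x <= y}.
Proof.
move=> x y xy; apply: ler_sum => k _; apply: ler_wpM2l; first exact: bweight_ge0.
by rewrite ler_nat; case: (leP (bnode R n k) x) => // /le_trans /(_ xy) ->.
Qed.

Let Gn_ge0 n x : 0 <= Gn n x.
Proof. by apply: sumr_ge0 => k _; rewrite mulr_ge0// bweight_ge0. Qed.

Let Gn_le n x : Gn n x <= c.
Proof.
rewrite -(sum_bweight n aP : _ = c); apply: ler_sum => k _.
by rewrite ler_piMr ?bweight_ge0//; case: (bnode R n k <= x).
Qed.

Let Gn_lt0 n x : x < 0 -> Gn n x = 0.
Proof.
move=> x0; rewrite /Gn big1// => k _; have /andP[b0 _] := bnode_itv R (ltn_ord k).
by rewrite leNgt (lt_le_trans x0 b0) mulr0.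
Qed.

Let Gn_ge1 n x : 1 <= x -> Gn n x = c.
Proof.
move=> x1; rewrite -(sum_bweight n aP : _ = c); apply: eq_bigr => k _.
have /andP[_ b1] := bnode_itv R (ltn_ord k).
by rewrite (le_trans b1 x1) mulr1.
Qed.

(** The grid runs from -1 to 1 with mesh [1 / (N + 1)]. Starting below 0 lets the left-open cells
    catch an atom at 0. *)
Let grid (N : nat) (i : nat) : R := i%:R / N.+1%:R - 1.

Let grid_nd N : {homo grid N : i j / (i <= j)%N >-> i <= j}.
Proof. by move=> i j ij; rewrite /grid lerD2r ler_pM2r ?invr_gt0// ler_nat. Qed.

Let grid0 N : grid N 0 = -1. Proof. by rewrite /grid mul0r sub0r. Qed.

Let grid_max N : grid N N.+1.*2 = 1.
Proof.
rewrite /grid -mul2n natrM mulfK ?pnatr_eq0//; lra.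
Qed.

Let gridS N i : grid N i.+1 = grid N i + N.+1%:R^-1.
Proof. by rewrite /grid -natr1 mulrDl mul1r addrAC. Qed.

(** A Riemann-Stieltjes sum for the [m]-th moment. The offset [e] allows the values of [right_reg G]
    at the grid points to be reached as limits of [G] from the right. *)
Let grid_sum (N m : nat) (G : R -> R) (e : R) : R :=
  \sum_(i < N.+1.*2) clip (grid N i) ^+ m * (G (grid N i.+1 + e) - G (grid N i + e)).

Let cell_dist N i x e : in_cell (fun i => grid N i + e) i x -> 0 <= e ->
  `|x - grid N i| <= N.+1%:R^-1 + e.
Proof.
move=> /andP[]; rewrite gridS; set h := N.+1%:R^-1; have h0 : 0 <= h by rewrite invr_ge0.
by move=> l u e0; rewrite ger0_norm; lra.
Qed.

(** Each node lies in one shifted cell, within [1 / (N + 1) + e < 2 / (N + 1)] of the left end of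
    the unshifted cell. The bound does not depend on [n], hence survives the limit along the
    ultrafilter. *)
Let bsum_grid N m n e : 0 < e -> e < N.+1%:R^-1 ->
  `|bsum a n (fun x => x ^+ m) - grid_sum N m (Gn n) e| <= c * (m%:R * (2 / N.+1%:R)).
Proof.
move=> e0 eN.
have e1 : e < 1 by apply: lt_le_trans eN _; rewrite invf_le1// ler1n.
pose T i := grid N i + e.
have T_nd : {homo T : i j / (i <= j)%N >-> i <= j}.
  by move=> i j ij; rewrite lerD2r grid_nd.
have -> : grid_sum N m (Gn n) e = \sum_(k < n.+2) bweight a n k *
    \sum_(i < N.+1.*2) clip (grid N i) ^+ m * (in_cell T i (bnode R n k))%:R.
  rewrite /grid_sum; under eq_bigr => i _.
    rewrite /Gn -sumrB mulr_sumr.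
    under eq_bigr => k _.
      rewrite -mulrBr mulrCA. over.
    over.
  rewrite exchange_big/=; apply: eq_bigr => k _; rewrite mulr_sumr.
  apply: eq_bigr => i _; congr (_ * (_ * _)).
  rewrite /in_cell /T; case: (leP (bnode R n k) (grid N i + e)) => h /=.
    by rewrite (le_trans h) ?subrr// T_nd.
  by rewrite subr0.
rewrite /bsum -sumrB -(sum_bweight n aP : _ = c) mulr_suml.
apply: le_trans (ler_norm_sum _ _ _) _; apply: ler_sum => k _.
rewrite -mulrBr normrM (ger0_norm (bweight_ge0 _ _ aP)).
apply: ler_wpM2l; first exact: bweight_ge0.
have bk := bnode_itv R (ltn_ord k); have /andP[b0 b1] := bk.
apply: (@cells_approx _ T T_nd (fun i => clip (grid N i) ^+ m)).
- move=> i _ ci; rewrite -{1}(clip_id bk).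
  apply: le_trans (norm_subX_le _ (norm_clip _) (norm_clip _)) _.
  apply: ler_wpM2l => //; apply: le_trans (clip_lipschitz _ _) _.
  apply: le_trans (cell_dist ci (ltW e0)) _.
  by move: eN; move: (N.+1%:R^-1 : R) => h; lra.
- by rewrite /T grid0; lra.
- by rewrite /T grid_max; lra.
Qed.

(* The distribution functions of the Bernstein measures, with mass [bweight a n k] at
   [bnode n k], converge pointwise along an ultrafilter; the Lebesgue-Stieltjes measure
   of the right-continuous regularization of the limit has the prescribed moments. *)
Lemma hausdorff_moment : exists nu : {finite_measure set (measurableTypeR R) -> \bar R},
  nu (~` `[0, 1]%classic) = 0%E /\
  forall m, \int[nu]_x (clip x ^+ m) = a m 0%N.
Proof.
(* [U] refines [\oo], so the limits of [bsum_cvg] remain valid along [U]. *)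
have [U [UU UF]] := @ultraFilterLemma nat \oo _.
have /choice[G GP] (x : R) : exists l : R, (fun n => Gn n x) @ U --> l.
  by apply: (@ultra_bounded_cvg _ _ _ c) => n; rewrite ger0_norm.
have GE x l : (forall n, Gn n x = l) -> G x = l.
  move=> h; have := GP x; have -> : (fun n => Gn n x) = (fun=> l) by apply/funext.
  by move=> /cvg_lim <- //; exact: lim_cst.
have G_nd : {homo G : x y / x <= y}.
  move=> x y xy; apply: ler_cvg_to (GP x) (GP y) _.
  by apply: nearW => n; exact: Gn_nd.
have G_ge0 x : 0 <= G x.
  by apply: ler_cvg_to (cvg_cst 0) (GP x) _; apply: nearW => n; exact: Gn_ge0.
have G0 x : x < 0 -> G x = 0 by move=> x0; apply: GE => n; exact: Gn_lt0.
have G1 x : 1 <= x -> G x = c by move=> x1; apply: GE => n; exact: Gn_ge1.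
pose F : cumulative R R := HB.pack_for (cumulative R R) (right_reg G)
  (isCumulative.Build R _ R (right_reg G) (right_reg_nd G_ge0)
    (right_reg_right_continuous G_ge0)).
have F0 x : x < 0 -> F x = 0.
  move=> x0; apply/eqP; rewrite eq_le; apply/andP; split.
    by rewrite -[leRHS](G0 (x / 2)); [apply: right_reg_le => //|]; lra.
  by apply: le_trans (right_reg_ge G_nd G_ge0 x); exact: G_ge0.
have F1 x : 1 <= x -> F x = c.
  move=> x1; apply/eqP; rewrite eq_le; apply/andP; split.
    by rewrite -[leRHS](G1 (x + 1)); [apply: right_reg_le => //|]; lra.
  by apply: le_trans (right_reg_ge G_nd G_ge0 x); rewrite G1.
(* Two limits in this order: [n] along [U] with [e] fixed, then [e] to 0 from the right, which turns
   [G] into [F]. *)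
have Fgrid N m : `|a m 0%N - grid_sum N m F 0| <= c * (m%:R * (2 / N.+1%:R)).
  have Ge e : 0 < e -> e < N.+1%:R^-1 ->
      `|a m 0%N - grid_sum N m G e| <= c * (m%:R * (2 / N.+1%:R)).
    move=> e0 eN.
    have mU : (fun n => bsum a n (fun x => x ^+ m)) @ U --> a m 0%N.
      by move=> B lB; apply: UF; exact: bsum_cvg lB.
    have gU : (fun n => grid_sum N m (Gn n) e) @ U --> grid_sum N m G e.
      apply: cvg_big => [|i _]; first exact: add_continuous.
      by apply: cvgMl_tmp; apply: cvgB; exact: GP.
    apply: ler_cvg_to (cvg_norm (cvgB mU gU)) (cvg_cst _) _.
    by apply: nearW => n; exact: bsum_grid.
  have gE : grid_sum N m G e @[e --> 0^'+] --> grid_sum N m F 0.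
    apply: cvg_big => [|i _]; first exact: add_continuous.
    by apply: cvgMl_tmp; rewrite !addr0; apply: cvgB; exact: right_reg_cvg.
  apply: ler_cvg_to (cvg_norm (cvgB (cvg_cst (a m 0%N)) gE)) (cvg_cst _) _.
  by near=> e; apply: Ge; near: e; [exact: nbhs_right_gt|exact: nbhs_right_lt].
pose mu := lebesgue_stieltjes_measure F.
have lerN11 : -1 <= 1 :> R by rewrite (le_trans (lerN10 R)).
have muE x y : x <= y -> mu `]x, y]%classic = (F y - F x)%:E.
  move=> xy; rewrite /mu /lebesgue_stieltjes_measure /measure_extension.
  by rewrite measurable_mu_extE/=; [rewrite wlength_itv_bnd|exact: is_ocitv].
(* [F] is constant on the negative reals and from 1 on, so restricting to []-1, 1]] loses no mass;
   it makes finiteness a computation. *)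
have mX : measurable (`]-1, 1]%classic : set (measurableTypeR R)) by exact: measurable_itv.
have nu_fin : fin_num_fun (mrestr mu mX).
  move=> A mA; rewrite ge0_fin_numE//; apply: (@le_lt_trans _ _ (mu `]-1, 1]%classic)).
    have mAX := measurableI _ _ mA mX.
    by apply: le_measure; rewrite ?inE//; exact: subIsetr.
  by rewrite (muE (-1) 1 lerN11) ltry.
pose nu : {finite_measure set (measurableTypeR R) -> \bar R} :=
  HB.pack (mrestr mu mX) (Measure_isFinite.Build _ _ _ (mrestr mu mX) nu_fin).
have nuE N i : (i < N.+1.*2)%N -> nu `]grid N i, grid N i.+1]%classic = (F (grid N i.+1) - F (grid N i))%:E.
  move=> iN; rewrite /nu/= /mrestr setIidl ?muE ?grid_nd// => x /=.
  rewrite !in_itv/= => /andP[ix xi]; apply/andP; split.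
    by apply: le_lt_trans ix; rewrite -(grid0 N) grid_nd.
  by apply: le_trans xi _; rewrite -(grid_max N) grid_nd.
have nuT : nu setT = c%:E.
  by rewrite /nu/= /mrestr setTI (muE (-1) 1 lerN11) F1// F0 ?subr0//.
have nuX : nu (~` `]-1, 1]%classic) = 0%E.
  by rewrite /nu/= /mrestr setICl; exact: (measure0 (lebesgue_stieltjes_measure F)).
have m01 : measurable (`[0, 1]%classic : set (measurableTypeR R)) by exact: measurable_itv.
exists nu; split.
  (* These intervals exhaust []-1, 0[], and each is null because [F] vanishes there. *)
  pose B n := `](-1 : R), (- n.+1%:R^-1 : R)]%classic.
  have mB n : measurable (B n : set (measurableTypeR R)) by exact: measurable_itv.
  have B0 n : nu (B n) = 0%E.
    apply/eqP; rewrite eq_le measure_ge0 andbT.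
    have n1 : -1 <= - n.+1%:R^-1 :> R by rewrite lerN2 invf_le1// ler1n.
    have n0 : - n.+1%:R^-1 < 0 :> R by rewrite oppr_lt0 invr_gt0.
    rewrite (@le_trans _ _ (mu (B n)))//.
      have mBX := measurableI _ _ (mB n) mX.
      by apply: le_measure; rewrite ?inE//; exact: subIsetl.
    by rewrite muE// !F0// ?subrr//; lra.
  have neg : nu.-negligible (~` `]-1, 1]%classic `|` \bigcup_n B n).
    apply: negligibleU; first by apply/negligibleP => //; exact: measurableC.
    by apply: negligible_bigcup => n; apply/(negligibleP nu (mB n)); exact: B0.
  apply: measure_negligible; first exact: measurableC.
  apply: negligibleS neg.
  move=> x /= x01; have [/= x1|] := boolP (x \in `]-1, 1]); last by move/negP; left.
  right; have x0 : x < 0.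
    by rewrite ltNge; apply/negP => x0; apply: x01; move: x1; rewrite !in_itv/= x0 => /andP[_ ->].
  exists (Num.truncn (- x)^-1) => //; move: x1; rewrite /B/= !in_itv/= => /andP[-> _]/=.
  rewrite lerNr -[leRHS]invrK lef_pV2 ?posrE ?invr_gt0 ?oppr_gt0//.
  by apply/ltW; exact: truncnS_gt.
move=> m; apply/eqP; rewrite -subr_eq0 -normr_le0.
apply/ler_addgt0Pl => e e0; rewrite addr0.
(* The factor 3 is 2 from [Fgrid] plus 1 from [sclip]. *)
have [N Ne] : exists N : nat, (c * m%:R * 3) * N.+1%:R^-1 <= e.
  exists (Num.truncn (c * m%:R * 3 / e)); rewrite ler_pdivrMr// [leRHS]mulrC -ler_pdivrMr//.
  by apply/ltW; exact: truncnS_gt.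
have mclip : measurable_fun [set: measurableTypeR R] (fun x => clip x ^+ m).
  by apply: measurable_funX; apply: continuous_measurable_fun; exact: clip_continuous.
have mcell i : measurable (`]grid N i, grid N i.+1]%classic : set (measurableTypeR R)).
  exact: measurable_itv.
pose s (x : measurableTypeR R) := \sum_(i < N.+1.*2)
  clip (grid N i) ^+ m * \1_(`]grid N i, grid N i.+1]%classic) x.
have sE : \int[nu]_x s x = grid_sum N m F 0.
  have := Rintegral_indic_sum nu (fun i => clip (grid N i) ^+ m) N.+1.*2 mcell.
  by move=> ->; apply: eq_bigr => i _; rewrite !addr0 nuE.
have sclip : `|\int[nu]_x (clip x ^+ m) - \int[nu]_x s x| <= c * (m%:R * N.+1%:R^-1).
  (* The step function [s] vanishes outside []-1, 1]], so the power is cut off there to make the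
     comparison uniform on the line. *)
  pose g (x : measurableTypeR R) := clip x ^+ m * \1_(`]-1, 1]%classic) x.
  have mg : measurable_fun [set: measurableTypeR R] g.
    by apply: measurable_funM => //; exact: measurable_indic.
  have ms : measurable_fun [set: measurableTypeR R] s.
    exact: (measurable_indic_sum (fun i => clip (grid N i) ^+ m) N.+1.*2 mcell).
  have -> : \int[nu]_x (clip x ^+ m) = \int[nu]_x g x.
    rewrite /Rintegral; congr fine; apply: ae_eq_integral => //;
      [exact/measurable_EFinP|exact/measurable_EFinP|].
    exists (~` `]-1, 1]%classic); split => //; first exact: measurableC.
    move=> x /= gx x1; apply: gx => _; rewrite /g indicE mem_set ?mulr1//.
  have gs x : `|g x - s x| <= m%:R * N.+1%:R^-1.
    have sin : s x = \sum_(i < N.+1.*2) clip (grid N i) ^+ m * (in_cell (grid N) i x)%:R.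
      by apply: eq_bigr => i _; rewrite indicE mem_setE in_itv.
    have [/andP[x1 x2]|xX] := boolP (-1 < x <= 1).
      rewrite /g indicE mem_setE in_itv/= x1 x2 mulr1 sin.
      apply: (@cells_approx _ _ (@grid_nd N) (fun i => clip (grid N i) ^+ m)).
      - move=> i _ ci; apply: le_trans (norm_subX_le _ (norm_clip _) (norm_clip _)) _.
        apply: ler_wpM2l => //; apply: le_trans (clip_lipschitz _ _) _.
        rewrite -[leRHS]addr0; apply: cell_dist => //.
        by move: ci; rewrite /in_cell !addr0.
      - by rewrite grid0.
      - by rewrite grid_max.
    rewrite /g indicE mem_setE in_itv/= (negbTE xX) mulr0 sub0r normrN sin big1 ?normr0 ?mulr_ge0//.
    move=> i _; apply/eqP; rewrite mulf_eq0 pnatr_eq0 eqb0; apply/orP; right.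
    apply: contra xX => /andP[ix xi]; apply/andP; split.
      by apply: le_lt_trans ix; rewrite -(grid0 N) grid_nd.
    by apply: le_trans xi _; rewrite -(grid_max N) grid_nd.
  have ig : nu.-integrable [set: _] (EFin \o g).
    apply: (@bounded_integrable _ _ _ _ _ 1) => // x; rewrite normrM normrX.
    by rewrite mulr_ile1 ?exprn_ge0 ?exprn_ile1 ?norm_clip// indicE; case: (_ \in _); rewrite ?normr1 ?normr0.
  have is' : nu.-integrable [set: _] (EFin \o s).
    apply: (@bounded_integrable _ _ _ _ _ (\sum_(i < N.+1.*2) `|clip (grid N i) ^+ m|)) => // x.
    exact: (norm_indic_sum_le (fun i => clip (grid N i) ^+ m) (fun i => `]grid N i, grid N i.+1]%classic)).
  rewrite -RintegralB//; apply: le_trans (le_normr_Rintegral _ _) _ => //.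
    by apply: (integrableB measurableT ig is').
  have -> : c * (m%:R / N.+1%:R) = \int[nu]_x (m%:R / N.+1%:R).
    by rewrite Rintegral_cst// [X in _ * fine X]nuT mulrC.
  apply: le_Rintegral => //.
  - by apply: (integrable_abse (integrableB measurableT ig is')).
  - exact: finite_measure_integrable_cst.
have := Fgrid N m; rewrite -sE distrC => h.
move: h sclip Ne; rewrite !ler_norml.
move: (N.+1%:R^-1 : R) (\int[nu]_x s x) (\int[nu]_x (clip x ^+ m)) => *.
lra.
Unshelve. all: by end_near. Qed.

End HausdorffMeasure.

(** * Determinacy of the moment problem *)

Section SignIteration.
Context (R : realType).
Implicit Types (s : R).

(* Newton-Schulz iteration: the polynomials [iter n sign_step 'X] converge pointwise
   and boundedly to the sign on [-1, 1]. *)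
Definition sign_step s : R := 2^-1 * (3 * s - s ^+ 3).

Lemma sign_step_itv s : 0 <= s <= 1 -> s <= sign_step s <= 1.
Proof.
move=> /andP[s0 s1]; rewrite /sign_step; apply/andP; split.
  have : 0 <= s * (1 - s) * (1 + s) by rewrite !mulr_ge0//; lra.
  by rewrite !exprS expr0; lra.
have : 0 <= (1 - s) * (1 - s) * (2 + s) by rewrite !mulr_ge0//; lra.
by rewrite !exprS expr0; lra.
Qed.

Lemma iter_sign_stepN n s : iter n sign_step (- s) = - iter n sign_step s.
Proof. by elim: n => //= n ->; rewrite /sign_step exprNn; ring. Qed.

Lemma iter_sign_step_itv n s : 0 <= s <= 1 -> s <= iter n sign_step s <= 1.
Proof.
move=> s01; elim: n => [|n /andP[l u]]; first by rewrite lexx; case/andP: s01.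
have /sign_step_itv/andP[l' ->] : 0 <= iter n sign_step s <= 1.
  by rewrite u andbT (le_trans _ l)//; case/andP: s01.
by rewrite (le_trans l l').
Qed.

Lemma norm_iter_sign_step n s : `|s| <= 1 -> `|iter n sign_step s| <= 1.
Proof.
wlog s0 : s / 0 <= s => [h s1|].
  have [/h|/ltW s0] := leP 0 s; first exact.
  by rewrite -(opprK s) iter_sign_stepN normrN h ?oppr_ge0// normrN.
rewrite ger0_norm// => s1; have /andP[l u] := iter_sign_step_itv n (introT andP (conj s0 s1)).
by rewrite ger0_norm// (le_trans s0 l).
Qed.

(** By oddness take [s > 0]. The iterates [t] stay above [s], and then each step multiplies [1 - t]
    by at most [1 - s / 2]. *)
Lemma iter_sign_step_cvg s : `|s| <= 1 -> (fun n => iter n sign_step s) @ \oo --> Num.sg s.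
Proof.
wlog s0 : s / 0 <= s => [h s1|].
  have [/h|/ltW s0] := leP 0 s; first exact.
  rewrite -(opprK s) sgrN; under eq_fun do rewrite iter_sign_stepN.
  by apply: cvgN; apply: h; rewrite ?oppr_ge0// normrN.
rewrite ger0_norm// => s1; have s01 : 0 <= s <= 1 by rewrite s0.
have [->|sN0] := eqVneq s 0.
  rewrite sgr0 (_ : (fun n => _) = fun=> 0); first exact: cvg_cst.
  by apply/funext; elim=> //= n ->; rewrite /sign_step expr0n/= mulr0 subr0 mulr0.
have sp : 0 < s by rewrite lt_neqAle eq_sym sN0.
rewrite gtr0_sg//; apply: (@squeeze_cvgr _ _ _ _ (fun n => 1 - (1 - s / 2) ^+ n) (fun=> 1)).
- apply: nearW => n; have /andP[_ ->] := iter_sign_step_itv n s01.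
  rewrite andbT lerBlDl -lerBlDr; elim: n => [|n IH]; first by rewrite /= expr0; lra.
  have /andP[l u] := iter_sign_step_itv n s01; move: IH l u; rewrite /= exprS.
  set t := iter n _ s; set e := _ ^+ n => IH l u.
  apply: (@le_trans _ _ ((1 - s / 2) * (1 - t))); last first.
    rewrite ler_pM2l; first exact: IH.
    by clear -sp s1; lra.
  have : 0 <= (1 - t) * ((t - s) + t ^+ 2) by apply: mulr_ge0; [|apply: addr_ge0; [|exact: sqr_ge0]]; lra.
  by rewrite /sign_step !exprS expr0; lra.
- rewrite -[X in _ --> X]subr0; apply: cvgB; first exact: cvg_cst.
  by apply: cvg_expr; rewrite ger0_norm; lra.
- exact: cvg_cst.
Qed.

End SignIteration.

Section MomentDeterminacy.
Context (R : realType) (nu : {finite_measure set (measurableTypeR R) -> \bar R}).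
Local Notation T := (measurableTypeR R).
Variable g : T -> R.
Hypothesis ig : nu.-integrable [set: T] (EFin \o g).

Let mg : measurable_fun [set: T] g.
Proof. by apply/measurable_EFinP; exact: measurable_int ig. Qed.

(** Stable under linear combinations and, by dominated convergence, under uniformly bounded
    pointwise limits. It is carried from polynomials to signs, then to indicators of rays and of
    Borel sets. *)
Definition annihilates (phi : T -> R) : Prop :=
  [/\ measurable_fun [set: T] phi, exists C, forall x, `|phi x| <= C &
      \int[nu]_x (g x * phi x) = 0].

Let integrable_mul (phi : T -> R) (C : R) : measurable_fun [set: T] phi ->
  (forall x, `|phi x| <= C) -> nu.-integrable [set: T] (EFin \o (fun x => g x * phi x)).
Proof.
move=> mphi phiC.
apply: (@le_integrable _ _ _ nu _ _ _ (fun x => C%:E * (EFin \o g) x)%E) => //.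
- by apply/measurable_EFinP; exact: measurable_funM.
- move=> x _; rewrite /= lee_fin !normrM mulrC ler_wpM2r// (le_trans (phiC x))//.
  exact: ler_norm.
- exact: integrableZl.
Qed.

Lemma annihilates_lin (a b : R) phi psi : annihilates phi -> annihilates psi ->
  annihilates (fun x => a * phi x + b * psi x).
Proof.
move=> [m1 [C1 b1] i1] [m2 [C2 b2] i2]; split.
- by apply: measurable_funD; apply: measurable_funM => //; exact: measurable_cst.
- exists (`|a| * C1 + `|b| * C2) => x; apply: le_trans (ler_normD _ _) _.
  by rewrite !normrM lerD ?ler_wpM2l.
- have -> : \int[nu]_x (g x * (a * phi x + b * psi x)) =
      \int[nu]_x (a * (g x * phi x) + b * (g x * psi x)).
    by apply: eq_Rintegral => x _; ring.
  have I1 := integrable_mul m1 b1; have I2 := integrable_mul m2 b2.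
  rewrite RintegralD//; [|exact: (integrableZl _ a I1)|exact: (integrableZl _ b I2)].
  by rewrite !RintegralZl// i1 i2 !mulr0 addr0.
Qed.

Lemma annihilates_lim (phi : nat -> T -> R) (psi : T -> R) (C : R) : (forall n, annihilates (phi n)) ->
  (forall n x, `|phi n x| <= C) -> (forall x, phi^~ x @ \oo --> psi x) ->
  annihilates psi.
Proof.
move=> phiP phiC phipsi.
have mphi n : measurable_fun [set: T] (phi n) by have [] := phiP n.
have mpsi : measurable_fun [set: T] psi.
  by apply: (@measurable_fun_cvg _ _ _ _ phi) => // x _; exact: phipsi.
have C0 : 0 <= C by exact: le_trans (normr_ge0 _) (phiC 0%N point).
split => //.
  exists C => x; apply: ler_cvg_to (cvg_norm (phipsi x)) (cvg_cst C) _.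
  by apply: nearW => n; exact: phiC.
have : (fun n => \int[nu]_x (g x * phi n x)%:E)%E @ \oo --> (\int[nu]_x (g x * psi x)%:E)%E.
  apply: (@dominated_cvg _ _ _ nu _ measurableT (fun n x => (g x * phi n x)%:E)
    _ (fun x => C%:E * `|(g x)%:E|)%E) => //.
  - by move=> n; apply/measurable_EFinP; exact: measurable_funM.
  - move=> x _; apply/cvg_EFin; first exact: nearW.
    by apply: cvgMl_tmp; exact: phipsi.
  - by apply: integrableZl => //; exact: integrable_abse.
  - by move=> n x _; rewrite /= lee_fin normrM mulrC ler_wpM2r.
have -> : (fun n => \int[nu]_x (g x * phi n x)%:E)%E = (fun=> 0%E).
  apply/funext => n; have [_ _ i0] := phiP n.
  rewrite -[LHS]fineK; first by congr EFin.
  exact: integrable_fin_num (integrable_mul (mphi n) (phiC n)).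
by move=> h; rewrite /Rintegral -(cvg_unique _ (cvg_cst 0%E) h).
Qed.

Hypothesis nu01 : nu (~` `[0, 1]%classic) = 0%E.
Hypothesis moments0 : forall m, \int[nu]_x (g x * clip x ^+ m) = 0.

Let mclip : measurable_fun [set: T] (@clip R : T -> R).
Proof. by apply: continuous_measurable_fun; exact: clip_continuous. Qed.

Lemma annihilates_poly (p : {poly R}) : annihilates (fun x => p.[clip x]).
Proof.
have X m : annihilates (fun x => clip x ^+ m).
  split => //; first exact: measurable_funX.
  by exists 1 => x; rewrite normrX exprn_ile1 ?norm_clip.
rewrite (_ : (fun x => _) = (fun x => \sum_(i < size p) p`_i * clip x ^+ i)); last first.
  by apply/funext => x; rewrite horner_coef.
elim: (size p) => [|n IH].
  under eq_fun do rewrite big_ord0.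
  split; [exact: measurable_cst|by exists 0 => x; rewrite normr0|].
  by under eq_Rintegral do rewrite mulr0; rewrite Rintegral_cst// mul0r.
under eq_fun do rewrite big_ord_recr/=.
have := annihilates_lin 1 p`_n IH (X n).
by under eq_fun do rewrite mul1r.
Qed.

Lemma annihilates_sign (l : R) : annihilates (fun x => Num.sg (clip x - l)).
Proof.
(* Dividing by [c] brings [clip x - l] into [-1, 1], where the iteration converges, without changing
   its sign. *)
pose c := 1 + `|l|; have c0 : 0 < c by rewrite ltr_pwDl.
pose p n := iter n (fun q : {poly R} => 2^-1%:P * (3%:P * q - q ^+ 3)) (c^-1%:P * ('X - l%:P)).
have pE n x : (p n).[x] = iter n (@sign_step R) ((x - l) / c).
  elim: n => [|n IH]; first by rewrite /= !hornerE mulrC.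
  by rewrite /= !hornerE ?horner_exp IH.
have b1 x : `|(clip x - l) / c| <= 1.
  rewrite normrM normfV (gtr0_norm c0) ler_pdivrMr// mul1r.
  by apply: le_trans (ler_normB _ _) _; rewrite lerD2r norm_clip.
apply: (@annihilates_lim (fun n x => (p n).[clip x]) _ 1).
- by move=> n; exact: annihilates_poly.
- by move=> n x; rewrite pE norm_iter_sign_step.
- move=> x; under eq_fun do rewrite pE.
  have -> : Num.sg (clip x - l) = Num.sg ((clip x - l) / c).
    by rewrite sgrM sgrV (gtr0_sg c0) mulr1.
  exact: iter_sign_step_cvg.
Qed.

(** Since the sign of 0 is 0, the sign at threshold [l] itself would give 1/2 at [l]. Thresholds
    increasing to [l] give the value 0 there. *)
Lemma annihilates_ray (l : R) : annihilates (fun x => (clip x < l)%R%:R).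
Proof.
have C : annihilates (fun=> 1).
  have := annihilates_poly 1; by under eq_fun do rewrite hornerE.
apply: (@annihilates_lim (fun n x => 2^-1 * 1 + (- 2^-1) * Num.sg (clip x - (l - n.+1%:R^-1))) _ 1).
- by move=> n; apply: annihilates_lin => //; exact: annihilates_sign.
- by move=> n x; case: sgrP => _; rewrite ler_norml; lra.
move=> x; have [xl|lx] := ltP (clip x) l.
  apply: cvg_near_cst; have xl0 : 0 < l - clip x by rewrite subr_gt0.
  exists (Num.truncn (l - clip x)^-1) => // n /= kn.
  have : n.+1%:R^-1 < l - clip x.
    rewrite -[ltRHS]invrK ltf_pV2 ?posrE ?invr_gt0//.
    by apply: lt_le_trans (truncnS_gt _) _; rewrite ler_nat.
  by move: (n.+1%:R^-1 : R) => i h; rewrite ltr0_sg; lra.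
apply: cvg_near_cst; apply: nearW => n.
have : 0 < n.+1%:R^-1 :> R by rewrite invr_gt0.
by move: (n.+1%:R^-1 : R) => i i0; rewrite gtr0_sg; [rewrite [RHS]mulr0n|]; lra.
Qed.

(** Dynkin's argument: the sets on which [g] has integral 0 form a lambda-system containing the
    rays, which are stable under intersection and generate the Borel sets. Concentration on [0, 1]
    is what removes [clip] from the rays. *)
Lemma moments0_ae_eq0 : {ae nu, forall x, g x = 0}.
Proof.
have ae01 : {ae nu, forall x, 0 <= x <= 1}.
  exists (~` `[0, 1]%classic); split => //; exact: (measurableC (measurable_itv `[0, 1])).
pose H : set (set T) := [set S | measurable S /\ \int[nu]_x (g x * \1_S x) = 0].
have i1 S : measurable S -> nu.-integrable [set: T] (EFin \o (fun x => g x * \1_S x)).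
  move=> mS; apply: (@integrable_mul _ 1); first exact: measurable_indic.
  by move=> x; rewrite indicE; case: (_ \in _); rewrite ?normr1 ?normr0.
have Hann S : annihilates (\1_S : T -> R) -> measurable S -> H S.
  by move=> [_ _ h] mS; split.
have annH S : H S -> annihilates (\1_S : T -> R).
  move=> [mS h]; split => //.
  by exists 1 => x; rewrite indicE; case: (_ \in _); rewrite ?normr1 ?normr0.
have HT : H setT.
  apply: Hann => //; have := annihilates_poly 1; under eq_fun do rewrite hornerE.
  by rewrite (_ : \1_setT = fun=> 1)//; apply/funext => x; rewrite indicT.
have HL : lambda_system setT H.
  split => //.
  - move=> A B BA HA HB; apply: Hann; last by apply: measurableD; [exact: HA.1|exact: HB.1].
    have := annihilates_lin 1 (-1) (annH _ HA) (annH _ HB).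
    congr annihilates; apply/funext => x; rewrite mul1r mulN1r !indicE in_setD.
    case: (boolP (x \in B)) => xB; rewrite ?andbT ?andbF ?subr0//=.
    by rewrite (_ : x \in A) ?subrr// inE; apply: BA; rewrite inE in xB.
  - move=> F ndF HF; apply: Hann; last by apply: bigcup_measurable => n _; exact: (HF n).1.
    apply: (@annihilates_lim (fun n => \1_(F n)) _ 1); first by move=> n; exact: annH.
      by move=> n x; rewrite indicE; case: (_ \in _); rewrite ?normr1 ?normr0.
    move=> x; apply: cvg_near_cst; have [[n _ Fnx]|nFx] := pselect ((\bigcup_n F n) x).
      exists n => // m /= nm; rewrite !indicE !mem_set//; first by exists n.
      by have /subsetPset := ndF _ _ nm; exact.
    apply: nearW => n; rewrite !indicE !memNset// => Fnx; by apply: nFx; exists n.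
have Hray : @RGenInftyO.G R `<=` H.
  move=> _ [l ->].
  have ml : measurable (`]-oo, l[%classic : set T) by exact: measurable_itv.
  split => //; have [_ _ h] := annihilates_ray l; rewrite -[RHS]h /Rintegral; congr fine.
  have [ma _ _] := annihilates_ray l.
  apply: ae_eq_integral => //.
  - by apply/measurable_EFinP; apply: measurable_funM => //; exact: measurable_indic.
  - by apply/measurable_EFinP; exact: measurable_funM.
  - have [N [mN N0 NP]] := ae01; exists N; split => // x /= hx; apply: NP => /= x01; apply: hx => _.
    by rewrite indicE mem_setE in_itv/= clip_id.
have GI : setI_closed (@RGenInftyO.G R).
  move=> _ _ [x ->] [y ->]; exists (Num.min x y).
  by apply/seteqP; split => z /=; rewrite !in_itv/= lt_min => /andP.
have Hall S : measurable S -> H S.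
  move=> mS; apply: (lambda_system_subset GI HL Hray) => //.
  have : (@ocitv R).-sigma.-measurable S := mS.
  by rewrite RGenInftyO.measurableE.
have := @integral_ae_eq _ _ _ nu [set: T] measurableT (cst 0%E) (EFin \o g) ig.
case.
- exact: measurable_cst.
- move=> E _ mE; rewrite integral0.
  have [_ h] := Hall E mE; rewrite -[LHS]fineK.
    rewrite -[RHS]/(0%:E); congr EFin; rewrite -[RHS]h -[LHS]/(Rintegral _ _ _) Rintegral_mkcond.
    by apply: eq_Rintegral => x _; rewrite patchE indicE; case: (_ \in _); rewrite ?mulr1 ?mulr0.
  by apply: integrable_fin_num => //; exact: integrableS ig.
- move=> N [mN N0 NP]; exists N; split => // x /= gx; apply: NP => /=.
  by apply: contra_not gx => /(_ Logic.I)[].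
Qed.

End MomentDeterminacy.

(** * Measures on countably many copies of the line *)

Section NatLine.
Context (R : realType).

Definition nat_line : Type := (nat * R)%type.

HB.instance Definition _ := Pointed.on nat_line.
HB.instance Definition _ := Topological.on nat_line.

Local Notation T := (measurableTypeR R).
Local Notation M := (borelType nat_line).

Definition fiber (k : nat) (t : T) : M := (k, t).

Lemma measurable_fiber k : measurable_fun [set: T] (fiber k).
Proof.
apply: (@measurability _ _ T M setT (fiber k) (@open nat_line)) => //.
move=> _ [U oU <-]; rewrite setTI.
have : open ((fun t : R => ((k, t) : (nat * R)%type)) @^-1` (U : set (nat * R)%type)).
  apply: open_comp => [t _|]; last exact: oU.
  have := @cvg_pair R nat R (nbhs t) (nbhs k) (nbhs t) _ _ _ (fun=> k) id (cvg_cst k) cvg_id.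
  exact.
exact: open_measurable.
Qed.

Lemma continuous_measurable_nat_line (h : nat_line -> R) : continuous h ->
  measurable_fun [set: M] (h : M -> R).
Proof.
move=> ch; apply: (measurability _ (RGenOpens.measurableE R)) => _ [_ [x [y ->]] <-].
rewrite setTI; apply: sub_sigma_algebra.
by move/continuousP : ch => /(_ _ (interval_open _ _)); apply.
Qed.

Lemma measurable_snd_nat_line : measurable_fun [set: M] (snd : M -> R).
Proof.
by apply: continuous_measurable_nat_line => -[n t]; exact: cvg_snd.
Qed.

Definition slice (k : nat) : set M := [set p : M | p.1 = k].

Lemma measurable_slice k : measurable (slice k).
Proof.
apply: sub_sigma_algebra.
have : open (fst @^-1` [set k] : set (nat * R)%type).
  by apply: open_comp => [[n t] _|]; [exact: cvg_fst|exact: discrete_open].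
by [].
Qed.

Variable nu : nat -> {finite_measure set T -> \bar R}.

Definition push (k : nat) : {measure set M -> \bar R} :=
  measure_function_pushforward__canonical__measure_function_Measure (nu k) (@measurable_fiber k).

(** The direct sum of the [nu k]. Its total mass may be infinite, but each slice has finite mass. *)
Definition nat_measure : set M -> \bar R := mseries push 0.

HB.instance Definition _ := Measure.on nat_measure.

Lemma nat_measureE S : nat_measure S = (\sum_(0 <= k <oo) nu k (fiber k @^-1` S))%E.
Proof. by []. Qed.

Lemma fiber_slice j k : fiber j @^-1` slice k = if j == k then setT else set0.
Proof.
case: eqVneq => [->|jk]; apply/seteqP; split => t //=.
by move/eqP; rewrite (negbTE jk).
Qed.

Lemma nneseries_single (a : nat -> \bar R) k : (forall j, j != k -> a j = 0)%E ->
  (\sum_(0 <= j <oo) a j = a k)%E.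
Proof.
move=> ak; apply: cvg_lim => //; apply: cvg_near_cst; exists k.+1 => // n /= kn.
rewrite big_mkord (bigD1 (Ordinal kn))//= big1 ?adde0// => i ik.
by apply: ak; apply: contra ik => /eqP ik; apply/eqP/val_inj.
Qed.

Let nat_measure_sigma_finite : sigma_finite [set: M] nat_measure.
Proof.
exists slice; first by apply/esym; rewrite -subTset => -[n t] _; exists n.
move=> k; split; first exact: measurable_slice.
rewrite nat_measureE (@nneseries_single _ k) => [|j jk]; last first.
  by rewrite fiber_slice (negbTE jk) measure0.
by rewrite fiber_slice eqxx -ge0_fin_numE// fin_num_measure.
Qed.

HB.instance Definition _ := @Measure_isSigmaFinite.Build _ _ _ nat_measure
  nat_measure_sigma_finite.

Lemma ge0_integral_slice k (h : M -> R) : measurable_fun [set: M] h ->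
  (forall x, 0 <= h x) -> (forall x, x.1 != k -> h x = 0) ->
  (\int[nat_measure]_x (h x)%:E = \int[nu k]_t (h (fiber k t))%:E)%E.
Proof.
move=> mh h0 hk; have mh' : measurable_fun [set: M] (EFin \o h) by exact/measurable_EFinP.
rewrite ge0_integral_measure_series//; last by move=> x _; rewrite lee_fin.
rewrite (@nneseries_single _ k) => [|j jk].
  rewrite ge0_integral_pushforward//; first exact: measurable_fiber.
  by move=> x _; rewrite lee_fin.
rewrite ge0_integral_pushforward//; first last.
- by move=> x _; rewrite lee_fin.
- exact: measurable_fiber.
by rewrite integral0_eq// => t _; rewrite /= hk.
Qed.

Lemma integral_slice k (h : M -> R) : measurable_fun [set: M] h ->
  (forall x, x.1 != k -> h x = 0) ->
  (\int[nat_measure]_x (h x)%:E = \int[nu k]_t (h (fiber k t))%:E)%E.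
Proof.
move=> mh hk; rewrite integralE [RHS]integralE.
have mp : measurable_fun [set: M] (fun x => Num.max (h x) 0).
  by apply: measurable_maxr => //; exact: measurable_cst.
have mn : measurable_fun [set: M] (fun x => Num.max (- h x) 0).
  by apply: measurable_maxr; [exact: measurable_funN|exact: measurable_cst].
congr (_ - _)%E.
  have := @ge0_integral_slice k _ mp.
  rewrite (_ : (fun x => (h x)%:E)^\+%E = (fun x => (Num.max (h x) 0)%:E)); last first.
    by apply/funext => x; rewrite funeposE EFin_max.
  rewrite (_ : (fun t => (h (fiber k t))%:E)^\+%E = (fun t => (Num.max (h (fiber k t)) 0)%:E)); last first.
    by apply/funext => x; rewrite funeposE EFin_max.
  by apply => [x|x xk]; [rewrite le_max lexx orbT|rewrite hk// maxxx].
have := @ge0_integral_slice k _ mn.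
rewrite (_ : (fun x => (h x)%:E)^\-%E = (fun x => (Num.max (- h x) 0)%:E)); last first.
  by apply/funext => x; rewrite funenegE EFin_max.
rewrite (_ : (fun t => (h (fiber k t))%:E)^\-%E = (fun t => (Num.max (- h (fiber k t)) 0)%:E)); last first.
  by apply/funext => x; rewrite funenegE EFin_max.
by apply => [x|x xk]; [rewrite le_max lexx orbT|rewrite hk// oppr0 maxxx].
Qed.

Lemma integrable_slice k (h : M -> R) : nat_measure.-integrable [set: M] (EFin \o h) ->
  (forall x, x.1 != k -> h x = 0) ->
  (nu k).-integrable [set: T] (EFin \o (h \o fiber k)).
Proof.
move=> /integrableP[mh ih] hk; have mh' : measurable_fun [set: M] h by exact/measurable_EFinP.
apply/integrableP; split.
  by apply/measurable_EFinP; apply: measurableT_comp => //; exact: measurable_fiber.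
rewrite -(@ge0_integral_slice k (fun x => `|h x|))// => [|x xk]; last by rewrite hk// normr0.
exact: measurableT_comp.
Qed.

Lemma negligible_nat_measure (P : set M) : measurable P ->
  (forall k, nu k (fiber k @^-1` P) = 0%E) -> nat_measure P = 0%E.
Proof. by move=> mP P0; rewrite nat_measureE eseries0. Qed.

End NatLine.

(** * Multiplication operators and singular values *)

Section RealMultiplication.
Context d (M : measurableType d) (R : realType) (mu : {measure set M -> \bar R}).
Implicit Types (f g : L2 mu) (phi psi : M -> R).

Definition bounded_measurable phi : Prop :=
  measurable_fun [set: M] phi /\ exists C, forall x, `|phi x| <= C.

(** For a bounded measurable [phi] the product is always square-integrable, so the default value of
    [in_L2] is never taken and a total function can replace [mulop]. *)
Definition rmul phi f : L2 mu := in_L2 mu (fun x => (phi x)%:C * repr f x).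

Lemma cmeasurable_real phi : measurable_fun [set: M] phi -> cmeasurable (fun x => (phi x)%:C).
Proof. by move=> mphi; split => //=; exact: measurable_cst. Qed.

Lemma sqr_modulus_real phi (h : M -> R[i]) x :
  sqr_modulus (fun y => (phi y)%:C * h y) x = phi x ^+ 2 * sqr_modulus h x.
Proof. by rewrite /sqr_modulus; case: (h x) => a b /=; ring. Qed.

Lemma square_integrable_rmul phi (h : M -> R[i]) : bounded_measurable phi ->
  square_integrable mu h -> square_integrable mu (fun x => (phi x)%:C * h x).
Proof.
move=> [mphi [C phiC]] hi; have mh := hi.1.
have mp : cmeasurable (fun x => (phi x)%:C * h x).
  by apply: cmeasurableM => //; exact: cmeasurable_real.
split => //.
have := integrableZl measurableT (C ^+ 2) (integrable_sqr_modulus hi).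
move=> /integrableP[_]; apply: le_lt_trans; apply: ge0_le_integral => //.
- by move=> x _; rewrite lee_fin sqr_modulus_ge0.
- by apply/measurable_EFinP; exact: measurable_sqr_modulus.
- apply: measurableT_comp => //; apply: measurable_funeM.
  by apply/measurable_EFinP; exact: measurable_sqr_modulus.
- move=> x _; rewrite lee_fin sqr_modulus_real.
  rewrite (le_trans _ (ler_norm _))// ler_wpM2r ?sqr_modulus_ge0//.
  by rewrite -real_normK ?num_real// ler_pXn2r// ?nnegrE// (le_trans _ (phiC x)).
Qed.

Lemma rmul_ae phi f : bounded_measurable phi ->
  {ae mu, forall x, repr (rmul phi f) x = (phi x)%:C * repr f x}.
Proof.
by move=> bphi; apply: in_L2_ae; apply: square_integrable_rmul => //; exact: L2fun_square_integrable.
Qed.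

Lemma inner_ae f g (h k : M -> R[i]) : cmeasurable h -> cmeasurable k ->
  {ae mu, forall x, repr f x = h x} -> {ae mu, forall x, repr g x = k x} ->
  '[f, g] = cintegral mu (fun x => h x * (k x)^*).
Proof.
move=> mh mk fh gk; apply: ae_eq_cintegral.
- by apply: cmeasurableM; [|apply: cmeasurable_conj]; exact: L2fun_cmeasurable.
- by apply: cmeasurableM => //; exact: cmeasurable_conj.
- by apply: filterS2 fh gk => x -> ->.
Qed.

Lemma inner_rmul phi f g : bounded_measurable phi -> '[rmul phi f, g] = '[f, rmul phi g].
Proof.
move=> bphi.
have m f' : cmeasurable (fun x => (phi x)%:C * repr f' x).
  by apply: cmeasurableM; [exact: cmeasurable_real bphi.1|exact: L2fun_cmeasurable].
rewrite (inner_ae (m f) (L2fun_cmeasurable (repr g)) (rmul_ae f bphi)); last exact: aeW.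
rewrite (inner_ae (L2fun_cmeasurable (repr f)) (m g) _ (rmul_ae g bphi)); last exact: aeW.
congr cintegral; apply/funext => x; case: (repr f x) (repr g x) => [a b] [a' b'].
by apply/eqP; rewrite eq_complex /=; apply/andP; split; apply/eqP; ring.
Qed.

Lemma L2_repr0 : {ae mu, forall x, repr (0 : L2 mu) x = 0}.
Proof.
have := L2_repr_linear (-1) (0 : L2 mu) 0; rewrite scaler0 addr0.
by apply: filterS => x ->; rewrite mulN1r addNr.
Qed.

(** Dominated convergence with bound [|f| ^ 2]. Convergence everywhere, to some limit, makes the
    limit integrand measurable; only almost everywhere is that limit known to be 1. *)
Lemma rmul_truncation_cvg (chi : nat -> M -> R) f :
  (forall n, measurable_fun [set: M] (chi n)) -> (forall n x, 0 <= chi n x <= 1) ->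
  {ae mu, forall x, chi^~ x @ \oo --> (1 : R)} ->
  (forall x, exists l, chi^~ x @ \oo --> (l : R)) ->
  ip_cvg (fun n => rmul (chi n) f) f.
Proof.
move=> mchi chi01 chi1 /choice[l chil].
have bchi n : bounded_measurable (chi n).
  by split => //; exists 1 => x; have /andP[? ?] := chi01 n x; rewrite ger0_norm.
pose h n x := (chi n x - 1) ^+ 2 * sqr_modulus (repr f) x.
have mf := L2fun_cmeasurable (repr f).
have mchi1 n : measurable_fun [set: M] (fun x => chi n x - 1).
  by apply: measurable_funB => //; exact: measurable_cst.
have mh n : measurable_fun [set: M] (h n).
  by apply: measurable_funM; [exact: measurable_funX|exact: measurable_sqr_modulus].
have sqnE n : (sqn (rmul (chi n) f - f))%:E = (\int[mu]_x (h n x)%:E)%E.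
  rewrite (@L2_sqn_ae _ _ _ _ _ (fun x => (chi n x - 1)%:C * repr f x)).
  - by apply: eq_integral => x _; rewrite sqr_modulus_real.
  - by apply: cmeasurableM => //; exact: cmeasurable_real.
  - apply: filterS2 (L2_repr_sub (rmul (chi n) f) f) (rmul_ae f (bchi n)) => x -> ->.
    by rewrite -[X in _ - X]mul1r -mulrBl rmorphB.
have hlim : (fun n => \int[mu]_x (h n x)%:E)%E @ \oo -->
    (\int[mu]_x ((l x - 1) ^+ 2 * sqr_modulus (repr f) x)%:E)%E.
  apply: (@dominated_cvg _ _ _ mu _ measurableT (fun n x => (h n x)%:E) _
    (EFin \o sqr_modulus (repr f))) => //.
  - by move=> n; exact/measurable_EFinP.
  - move=> x _; apply/cvg_EFin; first exact: nearW.
    apply: cvgMr_tmp; rewrite expr2 /comp/=; under eq_fun do rewrite expr2.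
    by apply: cvgM; apply: cvgB => //; exact: cvg_cst.
  - exact/integrable_sqr_modulus/L2fun_square_integrable.
  - move=> n x _; rewrite /= lee_fin ger0_norm; last first.
      by apply: mulr_ge0; [exact: sqr_ge0|exact: sqr_modulus_ge0].
    rewrite ler_piMl ?sqr_modulus_ge0// -real_normK ?num_real// exprn_ile1//.
    by have /andP[? ?] := chi01 n x; rewrite ler_norml; apply/andP; split; lra.
have l1 : {ae mu, forall x, l x = 1}.
  by apply: filterS chi1 => y c1; apply: (cvg_unique _ (chil y) c1).
have ml : measurable_fun [set: M] l.
  by apply: (@measurable_fun_cvg _ _ _ _ chi) => // t _; exact: chil.
have int0 : (\int[mu]_x ((l x - 1) ^+ 2 * sqr_modulus (repr f) x)%:E = 0)%E.
  rewrite -[RHS](@integral0 _ _ _ mu [set: M]); apply: ae_eq_integral => //.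
  - apply/measurable_EFinP; apply: measurable_funM; last exact: measurable_sqr_modulus.
    by apply: measurable_funX; apply: measurable_funB => //; exact: measurable_cst.
  - by apply: filterS l1 => t -> _; rewrite subrr expr0n/= mul0r.
rewrite int0 in hlim; rewrite /ip_cvg.
have -> : (fun n => sqn (rmul (chi n) f - f)) = fine \o (fun n => \int[mu]_x (h n x)%:E)%E.
  by apply/funext => n; rewrite /= -sqnE.
exact: fine_cvg hlim.
Qed.

End RealMultiplication.

(** * Construction of [U] and comparison of the domains *)

Section SingularValues.
Context (R : realType) (H K : hilbertType R) (A : partial_map H K).
Hypotheses (linA : linear_operator A) (closedA : closed_operator A).
Variable B : {linear H -> H}.
Hypothesis BP : is_resolvent A B.
Context d (M : measurableType d) (mu : {measure set M -> \bar R}).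
Variables (V : {linear L2 mu -> H}) (W : {linear H -> L2 mu}) (beta : M -> R).
Hypotheses (Viso : is_isometry V) (VW : is_adjoint V W).
Hypotheses (mbeta : measurable_fun [set: M] beta) (beta01 : forall x, 0 <= beta x <= 1).
Hypothesis beta_ae : {ae mu, forall x, 0 < beta x < 1}.
Hypothesis BV : forall f, B (V f) = V (rmul beta f).
Hypothesis Bfix : forall x, B (x - V (W x)) = x - V (W x).

(** The solution of [beta = 1 / (1 + sigma ^ 2)], as [B] inverts 1 + A^* A. Where [beta] is 0, on a
    null set, division gives 0. *)
Definition singular (x : M) : R := Num.sqrt ((1 - beta x) / beta x).

(** This is [beta * singular], written as a bounded function: [A B V f] has to be [U] of
    [sigma * beta * f]. *)
Let tau (x : M) : R := Num.sqrt (beta x * (1 - beta x)).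

(** On the set selected by [chi n], both [(beta x)^-1] and [singular x] are at most [n.+1]. *)
Let chi (n : nat) (x : M) : R := (n.+1%:R^-1 <= beta x)%R%:R.

Let beta_ge0 x : 0 <= beta x. Proof. by have /andP[] := beta01 x. Qed.
Let beta_le1 x : beta x <= 1. Proof. by have /andP[] := beta01 x. Qed.

Let bbeta : bounded_measurable beta.
Proof. by split => //; exists 1 => x; rewrite ger0_norm. Qed.

Let minv : measurable_fun [set: M] (fun x => (beta x)^-1).
Proof.
rewrite (_ : (fun x => _) = (@powR R ^~ (-1)) \o beta); last first.
  by apply/funext => x /=; rewrite powR_inv1.
by apply: measurableT_comp => //; exact: measurable_powR.
Qed.

Let m1beta : measurable_fun [set: M] (fun x => 1 - beta x).
Proof. by apply: measurable_funB => //; exact: measurable_cst. Qed.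

Let msqrt (h : M -> R) : measurable_fun [set: M] h ->
  measurable_fun [set: M] (fun x => Num.sqrt (h x)).
Proof.
move=> mh; apply: (measurableT_comp (f := @Num.sqrt R)) => //.
by apply: continuous_measurable_fun; exact: sqrt_continuous.
Qed.

Lemma measurable_singular : measurable_fun [set: M] singular.
Proof. by apply: msqrt; exact: measurable_funM. Qed.

Lemma singular_ge0 x : 0 <= singular x. Proof. exact: sqrtr_ge0. Qed.

Lemma singular_gt0 : {ae mu, forall x, 0 < singular x}.
Proof.
apply: filterS beta_ae => x /andP[b0 b1].
by rewrite sqrtr_gt0 divr_gt0// subr_gt0.
Qed.

Let tau_sqr x : tau x ^+ 2 = beta x - beta x ^+ 2.
Proof. by rewrite sqr_sqrtr ?mulr_ge0 ?subr_ge0//; ring. Qed.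

Let btau : bounded_measurable tau.
Proof.
split; first by apply: msqrt; exact: measurable_funM.
exists 1 => x; rewrite ger0_norm ?sqrtr_ge0// -(@ler_pXn2r _ 2) ?nnegrE ?sqrtr_ge0//.
by rewrite tau_sqr expr1n; have := sqr_ge0 (beta x); have := beta_le1 x; lra.
Qed.

Let tau_gt0 : {ae mu, forall x, 0 < tau x}.
Proof.
apply: filterS beta_ae => x /andP[b0 b1].
by rewrite sqrtr_gt0 mulr_gt0// subr_gt0.
Qed.

Let mchi n : measurable_fun [set: M] (chi n).
Proof.
rewrite (_ : chi n = \1_(beta @^-1` `[n.+1%:R^-1, +oo[%classic)); last first.
  apply/funext => x; rewrite indicE /chi; congr (nat_of_bool _)%:R.
  by apply/idP/idP; rewrite inE /= in_itv/= andbT.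
apply: measurable_indic; rewrite -[X in measurable X]setTI.
by apply: mbeta => //; exact: measurable_itv.
Qed.

Let chi01 n x : 0 <= chi n x <= 1.
Proof. by rewrite /chi; case: (n.+1%:R^-1 <= beta x); rewrite ?lexx ?ler01. Qed.

Let chi_beta n x : chi n x * (beta x * (beta x)^-1) = chi n x.
Proof.
rewrite /chi; case: (leP n.+1%:R^-1 (beta x)) => h; last by rewrite mul0r.
by rewrite divff ?mulr1// gt_eqF// (lt_le_trans _ h)// invr_gt0.
Qed.

Let bchi n : bounded_measurable (chi n).
Proof.
by split => //; exists 1 => x; have /andP[? ?] := chi01 n x; rewrite ger0_norm.
Qed.

Let bchib n : bounded_measurable (fun x => chi n x / beta x).
Proof.
split; first exact: measurable_funM.
exists n.+1%:R => x; rewrite /chi; case: (leP n.+1%:R^-1 (beta x)) => h; last by rewrite mul0r normr0.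
have b0 : 0 < beta x by apply: lt_le_trans h; rewrite invr_gt0.
by rewrite mul1r ger0_norm ?invr_ge0// -[leRHS]invrK lef_pV2 ?posrE// invr_gt0.
Qed.

Let singular_sqr x : 0 < beta x -> singular x ^+ 2 = (beta x)^-1 - 1.
Proof.
move=> b0; rewrite sqr_sqrtr ?divr_ge0 ?subr_ge0//.
by rewrite mulrBl mul1r divff// gt_eqF.
Qed.

Let chi_singular_sqr n x : (chi n x * singular x) ^+ 2 = chi n x / beta x - chi n x.
Proof.
rewrite exprMn /chi; case: (leP n.+1%:R^-1 (beta x)) => h; last by rewrite expr0n/= !mul0r subrr.
have b0 : 0 < beta x by apply: lt_le_trans h; rewrite invr_gt0.
by rewrite expr1n !mul1r singular_sqr.
Qed.

Let bchis n : bounded_measurable (fun x => chi n x * singular x).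
Proof.
split; first by apply: measurable_funM => //; exact: measurable_singular.
exists n.+1%:R => x.
have n1 : 1 <= n.+1%:R :> R by rewrite ler1n.
have cs0 : 0 <= chi n x * singular x.
  by rewrite mulr_ge0 ?singular_ge0//; have /andP[] := chi01 n x.
rewrite ger0_norm// -(@ler_pXn2r _ 2) ?nnegrE// chi_singular_sqr.
have [_ [C _]] := bchib n.
have h : chi n x / beta x <= n.+1%:R.
  rewrite /chi; case: (leP n.+1%:R^-1 (beta x)) => h; last by rewrite mul0r.
  have b0 : 0 < beta x by apply: lt_le_trans h; rewrite invr_gt0.
  by rewrite mul1r -[leRHS]invrK lef_pV2 ?posrE// invr_gt0.
have /andP[c0 _] := chi01 n x; rewrite expr2.
by apply: (@le_trans _ _ n.+1%:R); [lra|rewrite ler_peMr].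
Qed.

Let chi_tau n x : tau x * (chi n x / beta x) = chi n x * singular x.
Proof.
rewrite /chi; case: (leP n.+1%:R^-1 (beta x)) => h; last by rewrite !mul0r mulr0.
have b0 : 0 < beta x by apply: lt_le_trans h; rewrite invr_gt0.
rewrite !mul1r /tau /singular.
have -> : (beta x)^-1 = Num.sqrt ((beta x)^-1 ^+ 2).
  by rewrite sqrtr_sqr ger0_norm ?invr_ge0.
rewrite -sqrtrM ?mulr_ge0 ?subr_ge0//; congr Num.sqrt.
by rewrite expr2 sqrtr_sqr ger0_norm ?invr_ge0// mulrACA divff ?gt_eqF// mul1r.
Qed.

Let chi_cvg x : exists l, chi^~ x @ \oo --> (l : R).
Proof.
have [b0|b0] := ltP 0 (beta x).
  exists 1; apply: cvg_near_cst; exists (Num.truncn (beta x)^-1) => // n /= kn.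
  rewrite /chi (_ : _ <= _)%R// -[leRHS]invrK lef_pV2 ?posrE ?invr_gt0//.
  by apply/ltW/(lt_le_trans (truncnS_gt _)); rewrite ler_nat.
exists 0; apply: cvg_near_cst; apply: nearW => n.
by rewrite /chi leNgt (le_lt_trans b0) ?invr_gt0.
Qed.

Let chi_cvg1 : {ae mu, forall x, chi^~ x @ \oo --> (1 : R)}.
Proof.
apply: filterS beta_ae => x /andP[b0 _].
apply: cvg_near_cst; exists (Num.truncn (beta x)^-1) => // n /= kn.
rewrite /chi (_ : _ <= _)%R// -[leRHS]invrK lef_pV2 ?posrE ?invr_gt0//.
by apply/ltW/(lt_le_trans (truncnS_gt _)); rewrite ler_nat.
Qed.

Let trunc_cvg (f : L2 mu) : ip_cvg (fun n => rmul (chi n) f) f.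
Proof. exact: rmul_truncation_cvg. Qed.

Let rmulM (phi psi rho : M -> R) (f : L2 mu) : bounded_measurable phi -> bounded_measurable psi ->
  bounded_measurable rho -> (forall x, phi x * psi x = rho x) ->
  rmul phi (rmul psi f) = rmul rho f.
Proof.
move=> b1 b2 b3 e; apply: L2_ext.
apply: filterS3 (rmul_ae (rmul psi f) b1) (rmul_ae f b2) (rmul_ae f b3) => x -> -> ->.
by rewrite mulrA -rmorphM e.
Qed.

Let rmulB (phi psi rho : M -> R) (f : L2 mu) : bounded_measurable phi -> bounded_measurable psi ->
  bounded_measurable rho -> (forall x, phi x - psi x = rho x) ->
  rmul phi f - rmul psi f = rmul rho f.
Proof.
move=> b1 b2 b3 e; apply: L2_ext.
apply: filterS3 (L2_repr_sub (rmul phi f) (rmul psi f)) (rmul_ae f b3)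
  (filterI (rmul_ae f b1) (rmul_ae f b2)) => x -> -> [-> ->].
by rewrite -mulrBl -rmorphB e.
Qed.

(** The vectors [rmul tau f] are total because [tau > 0] almost everywhere. Their Gram matrix is
    that of the [A (B (V f))] since [tau ^ 2 = beta - beta ^ 2] mirrors [resolvent_energy]. *)
Let U_exists : exists2 U : {linear L2 mu -> K}, is_isometry U &
  forall f : L2 mu, U (rmul tau f) = A (B (V f)).
Proof.
apply: isometry_of_total; [exact: L2_complete|exact: hilbert_complete| |].
- move=> f f0.
  have tf : rmul tau f = 0.
    by apply: innerl_inj => g; rewrite (inner_rmul _ _ btau) f0 inner0l.
  apply: L2_ext; have := rmul_ae f btau; rewrite tf => ft.
  apply: filterS3 ft tau_gt0 (L2_repr0 mu) => x tfx t0 x0; rewrite x0 in tfx *.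
  have tN0 : (tau x)%:C != 0 :> R[i] by rewrite eq_complex /= eqxx andbT gt_eqF.
  by apply: (mulfI tN0); rewrite mulr0 -tfx.
- move=> f g; rewrite (inner_rmul _ _ btau).
  rewrite (resolvent_energy BP) !BV !Viso.
  rewrite (inner_rmul _ _ bbeta) (inner_rmul _ (rmul beta g) bbeta) -innerBr; congr ('[_, _]).
  have btau2 : bounded_measurable (fun x => beta x - beta x ^+ 2).
    split; first by apply: measurable_funB => //; exact: measurable_funX.
    exists 1 => x; have b0 := beta_ge0 x; have b1 := beta_le1 x.
    have := sqr_ge0 (beta x); have : 0 <= beta x * (1 - beta x) by rewrite mulr_ge0 ?subr_ge0.
    by rewrite expr2 => ? ?; rewrite ger0_norm; lra.
  have bbeta2 : bounded_measurable (fun x => beta x ^+ 2).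
    split; first exact: measurable_funX.
    by exists 1 => x; rewrite normrX exprn_ile1// ger0_norm.
  rewrite (rmulM _ btau btau btau2) => [|x]; last by rewrite -expr2 tau_sqr.
  rewrite (rmulM _ bbeta bbeta bbeta2) => [|x]; last by rewrite expr2.
  by rewrite (rmulB _ bbeta bbeta2 btau2).
Qed.

Lemma singular_value_decomposition : exists2 U : {linear L2 mu -> K}, is_isometry U &
  let T := mulop mu (fun m => (singular m)%:C) in
  domain A = [set x | domain T (W x)] /\ (forall x, domain A x -> A x = U (T (W x))).
Proof.
have [U Uiso UE] := U_exists; exists U => //=.
have [A0 AD AL] := linA.
(* Dividing the truncation of [f] by [beta] exhibits [V (rmul (chi n) f)] in the range of [B]: it
   lies in the domain, and [A] is known on it. *)
pose w n (f : L2 mu) := rmul (fun x => chi n x / beta x) f.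
have beta_w n f : rmul beta (w n f) = rmul (chi n) f.
  by apply: rmulM => // x; rewrite mulrCA chi_beta.
have tau_w n f : rmul tau (w n f) = rmul (fun x => chi n x * singular x) f.
  by apply: rmulM => // x; exact: chi_tau.
have BVw n f : B (V (w n f)) = V (rmul (chi n) f) by rewrite BV beta_w.
have AVw n f : A (V (rmul (chi n) f)) = U (rmul (fun x => chi n x * singular x) f).
  by rewrite -BVw -UE tau_w.
have inD x : square_integrable mu (fun m => (singular m)%:C * repr (W x) m) ->
    domain A x /\ A x = U (in_L2 mu (fun m => (singular m)%:C * repr (W x) m)).
  move=> si; set f := W x; pose h := in_L2 mu (fun m => (singular m)%:C * repr f m).
  have [Dn An] := resolvent_fixed BP (Bfix x).
  (* Only the component in the range of [V] is truncated; the remainder is fixed by [B] and killed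
     by [A]. *)
  pose u n := 1 *: (x - V f) + V (rmul (chi n) f).
  have DV n : domain A (V (rmul (chi n) f)) by rewrite -BVw; exact: (BP _).1.
  apply: (@closed_graph_cvg _ _ _ _ u) => //.
  - by move=> n; exact: AD.
  - rewrite /ip_cvg (_ : (fun n => _) = (fun n => sqn (rmul (chi n) f - f))); first exact: trunc_cvg.
    apply/funext => n; rewrite /u scale1r.
    rewrite (_ : x - V f + _ - x = V (rmul (chi n) f - f)); first by rewrite /sqn /rdot Viso.
    by rewrite linearB/= addrAC addrC addrAC subrr add0r.
  - rewrite /ip_cvg (_ : (fun n => _) = (fun n => sqn (rmul (chi n) h - h))); first exact: trunc_cvg.
    apply/funext => n; rewrite /= /u AL// An scaler0 add0r AVw.
    have -> : rmul (fun x => chi n x * singular x) f = rmul (chi n) h.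
      apply: L2_ext; apply: filterS3 (rmul_ae f (bchis n)) (rmul_ae h (bchi n)) (in_L2_ae si) => m -> ->.
      by rewrite -/h => ->; rewrite mulrA -rmorphM.
    by rewrite -linearB /sqn /rdot Uiso.
have VW' x g : '[x, V g] = '[W x, g] by rewrite innerC VW -innerC.
have Din x : domain A x -> square_integrable mu (fun m => (singular m)%:C * repr (W x) m).
  move=> Dx; set f := W x; pose k n := rmul (fun x => chi n x * singular x) f.
  have msf : cmeasurable (fun m => (singular m)%:C * repr f m).
    apply: cmeasurableM; last exact: L2fun_cmeasurable.
    exact/cmeasurable_real/measurable_singular.
  split => //.
  (* This difference also equals ['[A x, U (k n)]], by the defining identity of the resolvent at
     [V (w n f)] tested on [x]. *)
  have kE n : '[f, w n f] - '[f, rmul (chi n) f] = '[k n, k n].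
    rewrite -innerBr (inner_rmul _ _ (bchis n)); congr ('[_, _]).
    have bk2 : bounded_measurable (fun x => chi n x / beta x - chi n x).
      have [m1 [C1 h1]] := bchib n; have [m2 [C2 h2]] := bchi n.
      split; first exact: measurable_funB.
      exists (C1 + C2) => y; apply: le_trans (ler_normB _ _) _; exact: lerD.
    rewrite (rmulM _ (bchis n) (bchis n) bk2); last by move=> y; rewrite -chi_singular_sqr expr2.
    exact: rmulB.
  have Ak n : '[A x, U (k n)] = '[k n, k n].
    have e := (BP (V (w n f))).2 x Dx.
    rewrite BVw AVw !VW' -/f -/(k n) in e.
    by rewrite -kE -e addrAC subrr add0r.
  (* By Cauchy-Schwarz, [|k n| ^ 2 = <A x, U (k n)> <= |A x| |k n|], and one factor [|k n|]
     cancels. *)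
  have k_le n : sqn (k n) <= sqn (A x).
    have := rdot_CauchySchwarz (A x) (U (k n)); rewrite /rdot Ak -/(rdot _ _) -/(sqn _).
    rewrite (_ : sqn (U (k n)) = sqn (k n)); last by rewrite /sqn /rdot Uiso.
    have [->|k0] := eqVneq (sqn (k n)) 0; first by rewrite sqn_ge0.
    by rewrite expr2 ler_pM2r// lt_neqAle eq_sym k0 sqn_ge0.
  have kn_ae n : {ae mu, forall m, repr (k n) m = (chi n m * singular m)%:C * repr f m}.
    exact: rmul_ae.
  pose F n m := (sqr_modulus (fun y => (chi n y * singular y)%:C * repr f y) m)%:E.
  have mFc n : cmeasurable (fun y => (chi n y * singular y)%:C * repr f y).
    apply: cmeasurableM; last exact: L2fun_cmeasurable.
    by apply: cmeasurable_real; exact: (bchis n).1.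
  have mF n : measurable_fun [set: M] (F n) by exact/measurable_EFinP/measurable_sqr_modulus.
  have FE n : (\int[mu]_m F n m)%E = (sqn (k n))%:E by rewrite (L2_sqn_ae (mFc n) (kn_ae n)).
  apply: (@le_lt_trans _ _ (sqn (A x))%:E); last exact: ltry.
  (* The integrand is almost everywhere the limit of the truncated ones, so Fatou's lemma transfers
     the uniform bound [k_le]. *)
  have -> : (\int[mu]_m (sqr_modulus (fun y => (singular y)%:C * repr f y) m)%:E =
      \int[mu]_m limn_einf (F^~ m))%E.
    apply: ae_eq_integral => //.
    - exact/measurable_EFinP/measurable_sqr_modulus.
    - by apply: measurableT_comp => //; apply: measurable_fun_limn_esup => n; exact: measurableT_comp.
    apply: filterS chi_cvg1 => m c1 _; apply/esym; apply: (cvg_limn_einf_sup _).1.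
    apply/cvg_EFin; first exact: nearW.
    have h1 : (fun n => chi n m * singular m) @ \oo --> singular m.
      by rewrite -[X in _ --> X]mul1r; exact: cvgMr_tmp.
    rewrite sqr_modulus_real (_ : fine \o F^~ m =
        fun n => (chi n m * singular m) ^+ 2 * sqr_modulus (repr f) m); last first.
      by apply/funext => n; rewrite /F /= sqr_modulus_real.
    by apply: cvgMr_tmp; rewrite expr2; under eq_fun do rewrite expr2; exact: cvgM.
  apply: le_trans (fatou mu measurableT mF _) _.
    by move=> n m _; rewrite lee_fin sqr_modulus_ge0.
  rewrite limn_einf_lim; apply: lime_le; first exact: is_cvg_einfs.
  apply: nearW => n; apply: (@le_trans _ _ (\int[mu]_m F n m)%E).
    by apply: ereal_inf_lbound; exists n => /=.
  by rewrite FE lee_fin.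
split; last by move=> x /Din /inD[].
by apply/seteqP; split => x; [exact: Din|move=> /inD[]].
Qed.

End SingularValues.

(** * Cyclic decomposition and the spectral model *)

Section CyclicDecomposition.
Context (R : realType) (H : hilbertType R) (B : {linear H -> H}).
Hypothesis Bsa : forall x y, '[B x, y] = '[x, B y].
(** That is, B^2 <= B, which packs both [0 <= B] and [B <= 1] into one inequality. *)
Hypothesis Bpos : forall x, sqn (B x) <= rdot (B x) x.

Let C (x : H) : H := x - B x.

Let Csa x y : '[C x, y] = '[x, C y].
Proof. by rewrite innerBl innerBr Bsa. Qed.

Let rBsa x y : rdot (B x) y = rdot x (B y). Proof. by rewrite /rdot Bsa. Qed.

Let rCsa x y : rdot (C x) y = rdot x (C y). Proof. by rewrite /rdot Csa. Qed.

Let CB x : C (B x) = B (C x).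
Proof. by rewrite /C linearB. Qed.

Let iterCB l x : iter l C (B x) = B (iter l C x).
Proof. by elim: l => //= l ->. Qed.

Let iterBC k x : iter k B (C x) = C (iter k B x).
Proof. by elim: k => //= k ->. Qed.

Let iterBsa k x y : '[iter k B x, y] = '[x, iter k B y].
Proof. by elim: k x => // k IH x; rewrite iterSr IH Bsa. Qed.

Let iterB_linear k a x y : iter k B (a *: x + y) = a *: iter k B x + iter k B y.
Proof. by elim: k => //= k ->; rewrite linearP. Qed.

Definition operator_moments (v : H) (k l : nat) : R := rdot (iter k B (iter l C v)) v.

(** Moving one factor of each pair across the inner product replaces [v] by [B v] or [C v] and
    lowers an exponent by 2. This leaves exponents 0 or 1, where [Bpos] applies. The recursion is
    [B + C = 1]. *)
Lemma operator_moment_array v : moment_array (operator_moments v).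
Proof.
split; last first.
  have e z : B z + C z = z by rewrite /C addrC subrK.
  by move=> k l; rewrite /operator_moments -rdotDl !iterS iterBC e.
have step k l v' : 0 <= operator_moments (B v') k l ->
    0 <= operator_moments v' k.+2 l.
  by rewrite /operator_moments iterCB -iterSr -rBsa.
have stepC k l v' : 0 <= operator_moments (C v') k l ->
    0 <= operator_moments v' k l.+2.
  by rewrite /operator_moments -iterSr -rCsa -iterBC.
have base (b c : bool) v' : 0 <= operator_moments v' b c.
  have h := Bpos v'; have h2 := sqn_ge0 (B v'); have h3 := sqn_ge0 (v' - B v').
  move: b c => [] []; rewrite /operator_moments /=.
  - by rewrite /C linearB rdotDl rdotNl (rBsa (B v')) -/(sqn _); lra.
  - by apply: le_trans h.
  - by rewrite /C rdotDl rdotNl -/(sqn _); move: h3; rewrite sqnB rdotC; lra.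
  - exact: sqn_ge0.
have all k l : 0 <= operator_moments v k l.
  rewrite -(odd_double_half k) -(odd_double_half l) -!mul2n.
  elim: k./2 v => [|i IH] v0.
    rewrite muln0 addn0; elim: l./2 v0 => [|j IH] v1; first by rewrite muln0 addn0.
    by rewrite mulnS addnCA; exact: stepC.
  by rewrite mulnS addnCA; exact: step.
exact: all.
Qed.

Lemma operator_momentsE v m l :
  '[iter m B v, iter l B v] = (operator_moments v (m + l) 0)%:C.
Proof.
rewrite -iterBsa -iterD addnC /operator_moments /rdot /=.
have : '[iter (m + l) B v, v] = ('[iter (m + l) B v, v])^*.
  by rewrite -innerC iterBsa.
case: ('[_, _]) => a b /eqP; rewrite eq_complex /= => /andP[_ /eqP bN].
by congr (_ +i* _); lra.
Qed.

Variable d : nat -> H.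
Hypothesis d_total : forall x, (forall k, '[d k, x] = 0) -> x = 0.

Let d' k := C (d k).

Let ann (k : nat) : set H :=
  [set y | forall j, (j < k)%N -> forall m, '[y, iter m B (d' j)] = 0].

(* [W k], a biorthogonal, is the closed [B]-invariant subspace generated by the [d' j]
   with [j < k]. Taking the generators in the range of [1 - B] makes the cyclic vectors
   orthogonal to the kernel of [1 - B]. *)
Let W (k : nat) : set H := [set x | forall y, ann k y -> '[x, y] = 0].

Let W_closed k : closed_subspace (W k). Proof. exact: closed_subspace_perp. Qed.

Let annB k y : ann k y -> ann k (B y).
Proof. by move=> ky j jk m; rewrite Bsa -iterS ky. Qed.

Let WB k x m : W k x -> W k (iter m B x).
Proof.
move=> kx; elim: m => //= m IH y ky; rewrite Bsa; apply: IH; exact: annB.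
Qed.

Let W_le j k x : (j <= k)%N -> W j x -> W k x.
Proof.
move=> jk jx y ky; apply: jx => i ij m; apply: ky; exact: leq_trans jk.
Qed.

Let Wd j k : (j < k)%N -> W k (d' j).
Proof. by move=> jk y ky; rewrite innerC (ky j jk 0%N) rmorph0. Qed.

(** Gram-Schmidt on subspaces: [v k] is [d' k] minus its projection on [W k], and invariance of
    [W k] under [B] makes whole cyclic subspaces orthogonal. A vector [y] orthogonal to all of them
    is orthogonal to each [C (d k)], so [C y = 0]. Some [v k] may be 0. *)
Lemma cyclic_vectors : exists v : nat -> H,
  [/\ forall j k m l, j != k -> '[iter m B (v j), iter l B (v k)] = 0,
      forall y, (forall k m, '[y, iter m B (v k)] = 0) -> B y = y &
      forall z, B z = z -> forall k m, '[z, iter m B (v k)] = 0].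
Proof.
have /choice[p pP] k : exists p, W k p /\ forall s, W k s -> '[d' k - p, s] = 0.
  by have [p ? ?] := projection_theorem (d' k) (@hilbert_complete R H) (W_closed k); exists p.
pose v k := d' k - p k; exists v.
have Wv j k m : (j < k)%N -> W k (iter m B (v j)).
  move=> jk; apply: WB; have [_ WD _] := W_closed k.
  rewrite /v addrC -scaleN1r; apply: WD; last exact: Wd.
  by apply: W_le (pP j).1; exact: ltnW.
have orth j k m l : (j < k)%N -> '[iter l B (v k), iter m B (v j)] = 0.
  by move=> jk; rewrite iterBsa; apply: (pP k).2; apply: WB; exact: Wv.
have fixed_ann z k : B z = z -> ann k z.
  move=> Bz j jk m; rewrite -iterBsa (_ : iter m B z = z); last by elim: m => //= m ->.
  by rewrite /d' -Csa /C Bz subrr inner0l.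
split.
- move=> j k m l; rewrite neq_ltn => /orP[jk|kj]; last exact: orth.
  by rewrite innerC orth// rmorph0.
- move=> y yv; have yann k : ann k y.
    elim: k => // k IH j; rewrite ltnS leq_eqVlt => /orP[/eqP->|/IH//] m.
    have -> : d' k = 1 *: v k + p k by rewrite scale1r subrK.
    rewrite iterB_linear innerDr innerZr yv mulr0 add0r innerC.
    by rewrite (WB m (pP k).1)// rmorph0.
  apply/esym/eqP; rewrite -subr_eq0; apply/eqP/d_total => k.
  by rewrite -/(C y) -Csa innerC (yann k.+1 k (ltnSn k) 0%N) rmorph0.
- move=> z Bz k m; rewrite -iterBsa (_ : iter m B z = z); last by elim: m => //= m ->.
  rewrite /v innerBr (fixed_ann z k.+1 Bz k (ltnSn k) 0%N) sub0r innerC.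
  by rewrite (pP k).1 ?rmorph0 ?oppr0//; exact: fixed_ann.
Qed.

End CyclicDecomposition.

Lemma separable_sequence (R : realType) (H : hilbertType R) : separable H ->
  exists d : nat -> H, forall x, (forall k, '[d k, x] = 0) -> x = 0.
Proof.
move=> [S cS dS].
have [f finj] : exists f : H -> nat, {in S &, injective f} by exact/countable_injP.
have /choice[d dP] n : exists x, forall s, S s -> f s = n -> x = s.
  have [[s Ss fs]|nS] := pselect (exists2 s, S s & f s = n).
    by exists s => t St ft; apply: finj; rewrite ?inE// fs ft.
  (* Indices not attained on [S] get 0, which imposes no orthogonality condition. *)
  by exists 0 => s Ss fs; exfalso; apply: nS; exists s.
exists d => x dx; apply: (dense_perp dS) => s Ss.
by rewrite -(dP (f s) s Ss erefl) dx.
Qed.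

(** * The L2 model of [B] on the range of [V] *)

Section SpectralModel.
Context (R : realType) (nu : nat -> {finite_measure set (measurableTypeR R) -> \bar R}).
Hypothesis nu01 : forall k, nu k (~` `[0, 1]%classic) = 0%E.
Local Notation M := (borelType (nat_line R)).
Local Notation mu := (nat_measure nu).

Definition coordinate (p : M) : R := clip p.2.

(** The model of [B ^ m (v k)]. Despite the name, the family is total but not orthonormal. *)
Definition basis_fun (k m : nat) (p : M) : R := \1_(@slice R k) p * coordinate p ^+ m.

Definition basis (k m : nat) : L2 mu := in_L2 mu (fun p => (basis_fun k m p)%:C).

Lemma coordinate_itv p : 0 <= coordinate p <= 1. Proof. exact: clip_itv. Qed.

Lemma measurable_coordinate : measurable_fun [set: M] coordinate.
Proof.
apply: measurableT_comp (@measurable_snd_nat_line R).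
by apply: continuous_measurable_fun; exact: clip_continuous.
Qed.

Lemma bounded_coordinate : bounded_measurable coordinate.
Proof.
split; first exact: measurable_coordinate.
by exists 1 => p; exact: norm_clip.
Qed.

Lemma measurable_basis_fun k m : measurable_fun [set: M] (basis_fun k m).
Proof.
apply: measurable_funM; first by apply: measurable_indic; exact: measurable_slice.
apply: measurable_funX; exact: measurable_coordinate.
Qed.

Lemma basis_fun_out k m p : p.1 != k -> basis_fun k m p = 0.
Proof.
by move=> pk; rewrite /basis_fun indicE memNset ?mul0r//; exact/eqP.
Qed.

Lemma basis_fun_fiber k m t : basis_fun k m (fiber k t) = clip t ^+ m.
Proof. by rewrite /basis_fun indicE mem_set// mul1r. Qed.

Lemma basis_funM k m l p : basis_fun k m p * basis_fun k l p = basis_fun k (m + l) p.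
Proof.
by rewrite /basis_fun mulrACA -exprD indicE -natrM mulnb andbb.
Qed.

Lemma integral_basis_fun k m :
  (\int[mu]_p (basis_fun k m p)%:E = (\int[nu k]_t (clip t ^+ m))%:E)%E.
Proof.
rewrite (@integral_slice _ nu k _ (measurable_basis_fun k m)); last by move=> p; exact: basis_fun_out.
rewrite [RHS]fineK.
  by apply: eq_integral => t _; rewrite basis_fun_fiber.
apply: integrable_fin_num => //; apply: (@bounded_integrable _ _ _ _ _ 1) => [|t].
  apply: measurable_funX.
  by apply: continuous_measurable_fun; exact: clip_continuous.
by rewrite normrX exprn_ile1 ?norm_clip.
Qed.

Lemma square_integrable_basis k m : square_integrable mu (fun p => (basis_fun k m p)%:C).
Proof.
split; first by apply: cmeasurable_real; exact: measurable_basis_fun.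
under eq_integral => p _.
  rewrite /sqr_modulus /= expr0n/= addr0 expr2 basis_funM. over.
by rewrite integral_basis_fun ltry.
Qed.

Lemma basis_ae k m : {ae mu, forall p, repr (basis k m) p = (basis_fun k m p)%:C}.
Proof. by apply: in_L2_ae; exact: square_integrable_basis. Qed.

Lemma inner_basis f k m : '[f, basis k m] =
  (\int[mu]_p (complex.Re (repr f p) * basis_fun k m p))%R +i*
  (\int[mu]_p (complex.Im (repr f p) * basis_fun k m p))%R.
Proof.
rewrite (inner_ae (L2fun_cmeasurable (repr f)) (cmeasurable_real (measurable_basis_fun k m))
  (aeW _ _) (basis_ae k m)) => [|//].
congr (_ +i* _); apply: eq_Rintegral => p _; case: (repr f p) => a b /=; ring.
Qed.

Lemma inner_basis_basis k m j l : '[basis k m, basis j l] =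
  if k == j then (\int[nu k]_t (clip t ^+ (m + l)))%:C else 0.
Proof.
rewrite (inner_ae (cmeasurable_real (measurable_basis_fun k m))
  (cmeasurable_real (measurable_basis_fun j l)) (basis_ae k m) (basis_ae j l)).
rewrite (_ : (fun p => _) = (fun p => (basis_fun k m p * basis_fun j l p)%:C)); last first.
  by apply/funext => p; apply/eqP; rewrite eq_complex /=; apply/andP; split; apply/eqP; ring.
rewrite /cintegral /= Rintegral_cst// mul0r.
case: eqVneq => [<-|kj].
  congr (_ +i* _); rewrite /Rintegral; under eq_integral do rewrite basis_funM.
  by rewrite integral_basis_fun.
congr (_ +i* _); rewrite -[RHS](mul0r (fine (mu setT))) -Rintegral_cst//.
apply: eq_Rintegral => p _; have [pk|pk] := eqVneq p.1 k.
  by rewrite [basis_fun j _ _]basis_fun_out ?mulr0// pk.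
by rewrite basis_fun_out ?mul0r.
Qed.

Lemma rmul_basis k m : rmul coordinate (basis k m) = basis k m.+1.
Proof.
apply: L2_ext; apply: filterS3 (rmul_ae (basis k m) bounded_coordinate)
  (basis_ae k m) (basis_ae k m.+1) => p -> -> ->.
by rewrite -rmorphM /= /basis_fun exprS mulrCA.
Qed.

Lemma basis_fun0 k p : basis_fun k 0 p = (p.1 == k)%:R.
Proof.
rewrite /basis_fun expr0 mulr1 indicE; congr (nat_of_bool _)%:R.
by apply/idP/idP => [|/eqP pk]; rewrite inE// => /eqP.
Qed.

(* The real and imaginary parts of [f] on each slice have vanishing moments. *)
Lemma basis_total (f : L2 mu) : (forall i : nat * nat, '[f, basis i.1 i.2] = 0) -> f = 0.
Proof.
move=> f0; apply: L2_ext.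
have mf := L2fun_cmeasurable (repr f).
have part (g : M -> R) : measurable_fun [set: M] g ->
    (forall k, mu.-integrable [set: M] (EFin \o (fun p => g p * basis_fun k 0 p))) ->
    (forall k m, \int[mu]_p (g p * basis_fun k m p) = 0) ->
    {ae mu, forall p, g p = 0}.
  move=> mg ig g0.
  have mP : measurable [set p | g p != 0].
    rewrite (_ : [set p | _] = g @^-1` (~` [set 0])); last first.
      by apply/seteqP; split => p /= /eqP.
    by rewrite -[X in measurable X]setTI; apply: mg => //; exact: measurableC.
  exists [set p | g p != 0]; split => //; last by move=> p /= /eqP.
  apply: negligible_nat_measure => // k; apply: measure_negligible.
    by rewrite -[X in measurable X]setTI; exact: measurable_fiber.
  have out m p : p.1 != k -> g p * basis_fun k m p = 0.
    by move=> pk; rewrite basis_fun_out ?mulr0.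
  have igk : (nu k).-integrable [set: measurableTypeR R] (EFin \o (g \o fiber k)).
    have := integrable_slice (ig k) (out 0%N); rewrite (_ : _ \o fiber k = g \o fiber k)//.
    by apply/funext => t /=; rewrite basis_fun_fiber expr0 mulr1.
  have mom m : \int[nu k]_t ((g \o fiber k) t * clip t ^+ m) = 0.
    rewrite -[RHS](g0 k m) /Rintegral; congr fine.
    rewrite (@integral_slice _ nu k _ _ (out m)).
      by apply: eq_integral => t _ /=; rewrite basis_fun_fiber.
    by apply: measurable_funM => //; exact: measurable_basis_fun.
  have [N [mN N0 NP]] := moments0_ae_eq0 igk (nu01 k) mom.
  by exists N; split => // t /= gt; apply: NP => /= gt0; move: gt; rewrite gt0 eqxx.
have ifb k := cintegrable_mul_conj (L2fun_square_integrable (repr f)) (square_integrable_basis k 0).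
have re0 : {ae mu, forall p, complex.Re (repr f p) = 0}.
  apply: part; first exact: mf.1.
  - move=> k; have [h _] := ifb k; apply: eq_integrable h => // p _ /=.
    by case: (repr f p) => a b /=; congr EFin; ring.
  - by move=> k m; have := f0 (k, m); rewrite /= inner_basis => /(congr1 (@complex.Re R)).
have im0 : {ae mu, forall p, complex.Im (repr f p) = 0}.
  apply: part; first exact: mf.2.
  - move=> k; have [_ h] := ifb k; apply: eq_integrable h => // p _ /=.
    by case: (repr f p) => a b /=; congr EFin; ring.
  - by move=> k m; have := f0 (k, m); rewrite /= inner_basis => /(congr1 (@complex.Im R)).
apply: filterS3 re0 im0 (L2_repr0 mu) => p + + ->.
by case: (repr f p) => a b /= -> ->.
Qed.

Section Intertwining.
Context (H : hilbertType R) (B : {linear H -> H}) (v : nat -> H).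
Hypothesis Bsa : forall x y, '[B x, y] = '[x, B y].
Hypothesis Binj : forall x, B x = 0 -> x = 0.
Hypothesis nu_moments : forall k m, \int[nu k]_t (clip t ^+ m) = operator_moments B (v k) m 0.
Hypothesis v_orth : forall j k m l, j != k -> '[iter m B (v j), iter l B (v k)] = 0.
Hypothesis v_total : forall y, (forall k m, '[y, iter m B (v k)] = 0) -> B y = y.
Hypothesis v_fixed : forall z, B z = z -> forall k m, '[z, iter m B (v k)] = 0.

(** [V] sends [basis k m] to [B ^ m (v k)]: both Gram matrices record the moments of the [nu k],
    with orthogonality between different [k]. *)
Lemma spectral_model : exists (V : {linear L2 mu -> H}) (W : {linear H -> L2 mu}),
  [/\ is_isometry V, is_adjoint V W, forall f, B (V f) = V (rmul coordinate f),
      forall x, B (x - V (W x)) = x - V (W x) &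
      {ae mu, forall p, 0 < coordinate p < 1}].
Proof.
have [V Viso VE] : exists2 V : {linear L2 mu -> H}, is_isometry V &
    forall i : nat * nat, V (basis i.1 i.2) = iter i.2 B (v i.1).
  apply: isometry_of_total; [exact: L2_complete|exact: hilbert_complete|exact: basis_total|].
  move=> [k m] [j l] /=; rewrite inner_basis_basis; case: eqVneq => [<-|kj].
    by rewrite nu_moments operator_momentsE.
  by rewrite v_orth.
have {}VE k m : V (basis k m) = iter m B (v k) by exact: (VE (k, m)).
have [W VW] := isometry_adjoint (@L2_complete _ _ _ _) (@hilbert_complete R H) Viso.
have WV x f : '[x, V f] = '[W x, f] by rewrite innerC VW -innerC.
(* The intertwining is proved first for the adjoint, where testing on the total family is enough;
   the one for [V] follows by duality. *)
have WB y : W (B y) = rmul coordinate (W y).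
  apply/eqP; rewrite -subr_eq0; apply/eqP/basis_total => -[k m] /=.
  rewrite innerBl -WV VE Bsa -iterS -VE WV (inner_rmul _ _ bounded_coordinate).
  by rewrite rmul_basis subrr.
have BV f : B (V f) = V (rmul coordinate f).
  apply: innerl_inj => y; rewrite Bsa VW WB -(inner_rmul _ _ bounded_coordinate).
  by rewrite -VW.
(* [basis k 0] is the class of the indicator of slice [k], so the hypothesis says that [S] is null
   on every slice. *)
have ae_of (S : set M) : measurable S ->
    (forall k, rmul \1_S (basis k 0) = 0) -> {ae mu, forall p, ~ S p}.
  move=> mS S0.
  have bS : bounded_measurable (\1_S : M -> R).
    split; first exact: measurable_indic.
    by exists 1 => x; rewrite indicE; case: (_ \in _); rewrite ?normr1 ?normr0.
  have : {ae mu, forall p, forall k, p.1 = k -> ~ S p}.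
    apply/ae_foralln => k; have := rmul_ae (basis k 0) bS; rewrite S0.
    apply: filterS3 (basis_ae k 0) (L2_repr0 mu) => p -> -> + pk Sp.
    rewrite basis_fun0 pk eqxx indicE mem_set// mulr1 => /(congr1 (@complex.Re R))/= /eqP.
    by rewrite eq_sym oner_eq0.
  move=> [N [mN N0 NP]]; exists N; split => // p /= Sp; apply: NP => /= h.
  by apply: Sp; exact: h.
have mc := measurable_coordinate.
have mset1 (a : R) : measurable (coordinate @^-1` [set a]).
  by rewrite -[X in measurable X]setTI; apply: mc.
have bset1 (a : R) : bounded_measurable (\1_(coordinate @^-1` [set a]) : M -> R).
  split; first exact: measurable_indic.
  by exists 1 => x; rewrite indicE; case: (_ \in _); rewrite ?normr1 ?normr0.
have coord0 k : rmul coordinate (rmul \1_(coordinate @^-1` [set 0]) (basis k 0)) = 0.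
  set f := rmul _ (basis k 0); apply: L2_ext.
  apply: filterS3 (rmul_ae f bounded_coordinate) (rmul_ae (basis k 0) (bset1 0)) (L2_repr0 mu) => p e1 e2 e3.
  rewrite e1 [RHS]e3 [repr f p]e2 indicE; case: (boolP (p \in _)); last by rewrite mul0r mulr0.
  by rewrite inE => /= ->; rewrite mul0r.
have coord1 k : rmul coordinate (rmul \1_(coordinate @^-1` [set 1]) (basis k 0)) =
    rmul \1_(coordinate @^-1` [set 1]) (basis k 0).
  pose f := rmul \1_(coordinate @^-1` [set 1]) (basis k 0); apply: L2_ext; rewrite -/f.
  apply: filterS2 (rmul_ae f bounded_coordinate) (rmul_ae (basis k 0) (bset1 1)) => p e1 e2.
  apply: (etrans e1); move: e2; rewrite -/f; move: (repr f p) (repr (basis k 0) p) => y r ->.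
  have [pS|pS] := boolP (p \in coordinate @^-1` [set 1]).
    have -> : coordinate p = 1 by move: pS; rewrite inE.
    exact: mul1r.
  have -> : (\1_(coordinate @^-1` [set 1]) p)%:C = 0 :> R[i] by rewrite indicE (negbTE pS).
  by move: (coordinate p)%:C => c; rewrite mul0r mulr0.
(* The part of [basis k 0] over beta = 0 is mapped by [V] into the kernel of [B]. *)
have ae0 : {ae mu, forall p, ~ (coordinate @^-1` [set 0]) p}.
  apply: (ae_of _ (mset1 0)) => k; pose f := rmul \1_(coordinate @^-1` [set 0]) (basis k 0).
  have Vf0 : V f = 0 by apply: Binj; rewrite BV /f coord0 linear0.
  by rewrite -/f; apply: sqn_eq0; rewrite /sqn /rdot -Viso Vf0 inner0l.
(* The part over beta = 1 is mapped to a fixed vector of [B], which is orthogonal to all cyclic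
   vectors, hence to the range of [V]. *)
have ae1 : {ae mu, forall p, ~ (coordinate @^-1` [set 1]) p}.
  apply: (ae_of _ (mset1 1)) => k; pose f := rmul \1_(coordinate @^-1` [set 1]) (basis k 0).
  have BVf : B (V f) = V f by rewrite BV /f coord1.
  rewrite -/f; apply: basis_total => -[j m] /=; rewrite -Viso VE; exact: v_fixed.
exists V, W; split => //.
- move=> x; apply: v_total => k m.
  by rewrite -VE innerBl WV Viso subrr.
- apply: filterS2 ae0 ae1 => p /= /eqP c0 /eqP c1; have /andP[p0 p1] := coordinate_itv p.
  by rewrite !lt_neqAle eq_sym c0 p0 c1 p1.
Qed.

End Intertwining.

End SpectralModel.


Theorem theorem3p1 (R : realType) (H K : hilbertType R)
    (sepH : separable H) (sepK : separable K) (A : partial_map H K)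
    (linA : linear_operator A) (closedA : closed_operator A)
    (denseA : densely_defined A) :
  exists (M : ptopologicalType)
         (mu : {sigma_finite_measure set (borelType M) -> \bar R})
         (U : {linear L2 mu -> K}) (V : {linear L2 mu -> H})
         (Vstar : {linear H -> L2 mu}) (sigma : borelType M -> R),
    (is_isometry U /\ is_isometry V /\ is_adjoint V Vstar) /\
    [/\ measurable_fun [set: borelType M] sigma,
        (forall m, 0 <= sigma m) &
        {ae mu, forall m, 0 < sigma m}] /\
    let T_sigma := mulop mu (fun m => (sigma m)%:C) in
    domain A = [set x | domain T_sigma (Vstar x)] /\
    (forall x, domain A x -> A x = U (T_sigma (Vstar x))).
Proof.
have [B BP] := resolvent_exists linA closedA.
have Bsa := resolvent_selfadjoint BP.
(* This is [|A (B x)| ^ 2 >= 0], rewritten by [resolvent_energy]. *)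
have Bpos x : sqn (B x) <= rdot (B x) x.
  have := sqn_ge0 (A (B x)); rewrite {1}/sqn /rdot (resolvent_energy BP).
  by rewrite /sqn /rdot; case: ('[B x, x]) ('[B x, B x]) => [a b] [a' b'] /=; lra.
have [d d_total] := separable_sequence sepH.
have [v [v_orth v_total v_fixed]] := cyclic_vectors Bsa d_total.
have /choice[nu nuP] k : exists nu : {finite_measure set (measurableTypeR R) -> \bar R},
    nu (~` `[0, 1]%classic) = 0%E /\
    forall m, \int[nu]_x (clip x ^+ m) = operator_moments B (v k) m 0.
  exact: hausdorff_moment (operator_moment_array Bsa Bpos (v k)).
have nu01 k := (nuP k).1; have nu_moments k := (nuP k).2.
have [V [W [Viso VW BV Bfix coord01]]] := spectral_model nu01 Bsa
  (resolvent_inj linA denseA BP) nu_moments v_orth v_total v_fixed.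
have mc := measurable_coordinate (R := R).
have [U Uiso [domE AE]] := singular_value_decomposition linA closedA BP Viso VW mc
  (@coordinate_itv R) coord01 BV Bfix.
exists (nat_line R), (nat_measure nu), U, V, W, (singular (@coordinate R)).
split; first by [].
split; last by [].
split; [exact: (measurable_singular mc (@coordinate_itv R))|exact: singular_ge0|exact: singular_gt0].
Qed.
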